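(* For any $\alpha\ge1$ and $F_t\in\mathbb A_t^{[\alpha]}\langle\langle z\rangle\rangle$, there exists a unique $K$-Hopf algebra homomorphism $\mathcal S_{F_t}:\mathcal N\mathrm{Sym}\to\mathcal D^{[\alpha]}\langle\langle z\rangle\rangle$ such that $\mathcal S_{F_t}^{\times5}(\Pi)=\Omega_{F_t}$ (where $\mathcal S_{F_t}$ is extended coefficientwise to power series in $t$). More precisely, for any $m\ge1$, $$\mathcal S_{F_t}(\Lambda_m)=\lambda_m,\quad \mathcal S_{F_t}(S_m)=s_m,\quad \mathcal S_{F_t}(\Psi_m)=\psi_m,\quad \mathcal S_{F_t}(\Phi_m)=\phi_m,\quad \mathcal S_{F_t}(\Xi_m)=\xi_m.$$
   Context: Setup. $K$ is a unital commutative $\mathbb Q$-algebra, $z=(z_1,\dots,z_n)$ ($n\ge 1$) are independent variables, either commutative or noncommutative (free); statements hold in both cases and the same notation is used for both. $t$ is a formal parameter commuting with everything. $K\langle\langle z\rangle\rangle$ and $K[[t]]\langle\langle z\rangle\rangle$ are the formal power series algebras in $z$ over $K$ and $K[[t]]$. $o(u)$ is the lowest degree in $z$ of the monomials occurring in $u$ (for a vector, the minimum over its components). For $\vec u=(u_1,\dots,u_n)$ a vector of power series, $[\vec u\,\frac{\partial}{\partial z}]$ is the unique derivation (over $K$, resp. $K[[t]]$) sending $z_i$ to $u_i$ for each $i$; every derivation is of this form. $\mathcal Der^{[\alpha]}\langle\langle z\rangle\rangle$ is the set of $K$-derivations of $K\langle\langle z\rangle\rangle$ that increase the degree in $z$ by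 at least $\alpha-1$ (i.e. $[\vec u\frac{\partial}{\partial z}]$ with $o(\vec u)\ge\alpha$), and $\mathcal D^{[\alpha]}\langle\langle z\rangle\rangle$ is the unital subalgebra of $\mathrm{End}_K(K\langle\langle z\rangle\rangle)$ generated by $\mathcal Der^{[\alpha]}\langle\langle z\rangle\rangle$. Elements of $\mathcal D^{[\alpha]}\langle\langle z\rangle\rangle[[t]]$ act $K[[t]]$-linearly on $K[[t]]\langle\langle z\rangle\rangle$ in the obvious way. Hopf structure on differential operators (the paper's convention): the algebra generated by derivations is identified with the universal enveloping algebra of the Lie algebra of derivations, and carries the corresponding $K$-Hopf algebra structure, determined on derivations $\delta$ by $\Delta(\delta)=1\otimes\delta+\delta\otimes1$, $S(\delta)=-\delta$, $\epsilon(\delta)=\delta\cdot1$ $(=0)$; $\mathcal D^{[\alpha]}\langle\langle z\rangle\rangle$ carries this structure. $\mathbb A_t^{[\alpha]}\langle\langle z\rangle\rangle$ is the set of automorphisms $F_t(z)=z-H_t(z)$ of $K[[t]]\langle\langle z\rangle\rangle$ over $K[[t]]$ with $H_t(z)\in K[[t]]\langle\langle z\rangle\rangle^{\times n}$, $o(H_t(z))\ge\alpha$ and $H_{t=0}(z)=0$. The inverse map is written $G_t(z)=F_t^{-1}(z)=z+M_t(z)$; then $o(M_t)\ge\alpha$ and $M_{t=0}=0$. $u(F_t)$ denotes substitution of $F_t(z)$ for $z$ in $u$. The 5-tuple $\Omega_{F_t}=(f(t),g(t),d(t),h(t),m(t))$. $f(t)=\sum_{m\ge0}t^m\lambda_m$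 and $g(t)=\sum_{m\ge0}t^m s_m$, where $\lambda_m,s_m\in\mathcal D^{[\alpha]}\langle\langle z\rangle\rangle$ are the unique sequences with $\lambda_0=s_0=1$ such that $f(-t)u_t(z)=u_t(F_t)$ and $g(t)u_t(z)=u_t(G_t)$ for all $u_t(z)\in K[[t]]\langle\langle z\rangle\rangle$. $d(t)=\sum_{m\ge1}\frac{t^m}{m}\phi_m:=-[a_t(z)\frac{\partial}{\partial z}]$, where $a_t(z)\in K[[t]]\langle\langle z\rangle\rangle^{\times n}$ (the D-Log of $F_t$) is the unique vector with $a_{t=0}(z)=0$, $o(a_t(z))\ge\alpha$ and $e^{[a_t(z)\frac{\partial}{\partial z}]}\cdot z=F_t(z)$. $h(t)=\sum_{m\ge1}\psi_m t^{m-1}:=[\frac{\partial M_t}{\partial t}(F_t)\frac{\partial}{\partial z}]$ and $m(t)=\sum_{m\ge1}\xi_m t^{m-1}:=[\frac{\partial H_t}{\partial t}(G_t)\frac{\partial}{\partial z}]$. Noncommutative symmetric functions. $\mathcal N\mathrm{Sym}=K\langle\Lambda\rangle$ is the free associative $K$-algebra on $\Lambda_m$ ($m\ge1$), $\Lambda_0=1$. $\Pi=(\lambda(t),\sigma(t),\Phi(t),\psi(t),\xi(t))$ is the $5$-tuple over $\mathcal N\mathrm{Sym}[[t]]$ with $\lambda(t)=\sum_{m\ge0}t^m\Lambda_m$ and the other components determined uniquely by $\lambda(-t)\sigma(t)=\sigma(t)\lambda(-t)=1$, $e^{\Phi(t)}=\sigma(t)$, $\frac{d\sigma(t)}{dt}=\sigma(t)\psi(t)$,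 $\frac{d\sigma(t)}{dt}=\xi(t)\sigma(t)$; the elements $S_m,\Phi_m,\Psi_m,\Xi_m$ are defined by $\sigma(t)=\sum_{m\ge0}t^mS_m$, $\Phi(t)=\sum_{m\ge1}t^m\frac{\Phi_m}{m}$, $\psi(t)=\sum_{m\ge1}t^{m-1}\Psi_m$, $\xi(t)=\sum_{m\ge1}t^{m-1}\Xi_m$. $\mathcal N\mathrm{Sym}$ is a $K$-Hopf algebra with $\epsilon(\Psi_m)=0$, $\Delta(\Psi_m)=1\otimes\Psi_m+\Psi_m\otimes1$, $S(\Psi_m)=-\Psi_m$ for $m\ge1$.
   Formalization: The Hopf algebra D^[α] is taken to be the universal enveloping algebra of Der^[α], as its Hopf structure need not descend to operators; S maps into it, S(Π)=Ω and the five equalities hold for the induced operators, and uniqueness is among such S. *)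

(* Defs.v *)
From HB Require Import structures.
From mathcomp Require Import all_boot all_order all_algebra.
From mathcomp Require Import boolp finmap generic_quotient ring_quotient.
From mathcomp Require Import monalg.

Set Implicit Arguments.
Unset Strict Implicit.
Unset Printing Implicit Defensive.

Import GRing.Theory.
Local Open Scope ring_scope.
Local Open Scope quotient_scope.

(* -------------------------------------------------------------------- *)
Section Endo.
Variables (K : comNzRingType) (V : lalgType K).

Record endo := Endo { endo_fun :> V -> V; endo_linear : linear endo_fun }.

HB.instance Definition _ := gen_eqMixin endo.
HB.instance Definition _ := gen_choiceMixin endo.

Lemma endoP (f g : endo) : f =1 g -> f = g.
Proof.
case: f g => f hf [g hg] /= /funext fg; move: hf; rewrite fg => hf.
by congr Endo; exact: Prop_irrelevance.
Qed.

Let lin (f : endo) := GRing.isLinear.Build K V V *:%R f (endo_linear f).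
Let L (f : endo) : {linear V -> V} := HB.pack (endo_fun f) (lin f).
Let fD (f : endo) x y : f (x + y) = f x + f y. Proof. exact: (linearD (L f)). Qed.
Let fZ (f : endo) k x : f (k *: x) = k *: f x. Proof. exact: (linearZZ (L f)). Qed.

Fact endo_zero_subproof : linear (fun _ : V => 0 : V).
Proof. by move=> k x y; rewrite scaler0 addr0. Qed.
Fact endo_one_subproof : linear (fun x : V => x).
Proof. by []. Qed.
Fact endo_opp_subproof (f : endo) : linear (fun x => - f x).
Proof. by move=> k x y; rewrite fD fZ opprD scalerN. Qed.
Fact endo_add_subproof (f g : endo) : linear (fun x => f x + g x).
Proof. by move=> k x y; rewrite !fD !fZ scalerDr addrACA. Qed.
Fact endo_mul_subproof (f g : endo) : linear (fun x => f (g x)).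
Proof. by move=> k x y; rewrite !fD !fZ. Qed.
Fact endo_scale_subproof c (f : endo) : linear (fun x => c *: f x).
Proof. by move=> k x y; rewrite !fD !fZ scalerDr !scalerA mulrC. Qed.

Definition endo_zero := Endo endo_zero_subproof.
Definition endo_one := Endo endo_one_subproof.
Definition endo_opp f := Endo (endo_opp_subproof f).
Definition endo_add f g := Endo (endo_add_subproof f g).
Definition endo_mul f g := Endo (endo_mul_subproof f g).
Definition endo_scale c f := Endo (endo_scale_subproof c f).

Fact endo_addA : associative endo_add.
Proof. by move=> f g h; apply: endoP => x /=; rewrite addrA. Qed.
Fact endo_addC : commutative endo_add.
Proof. by move=> f g; apply: endoP => x /=; rewrite addrC. Qed.
Fact endo_add0 : left_id endo_zero endo_add.
Proof. by move=> f; apply: endoP => x /=; rewrite add0r. Qed.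
Fact endo_addN : left_inverse endo_zero endo_opp endo_add.
Proof. by move=> f; apply: endoP => x /=; rewrite addNr. Qed.
Fact endo_mulA : associative endo_mul.
Proof. by move=> f g h; apply: endoP. Qed.
Fact endo_mul1 : left_id endo_one endo_mul.
Proof. by move=> f; apply: endoP. Qed.
Fact endo_mulr1 : right_id endo_one endo_mul.
Proof. by move=> f; apply: endoP. Qed.
Fact endo_mulDl : left_distributive endo_mul endo_add.
Proof. by move=> f g h; apply: endoP. Qed.
Fact endo_mulDr : right_distributive endo_mul endo_add.
Proof. by move=> f g h; apply: endoP => x /=; rewrite fD. Qed.

HB.instance Definition _ := GRing.isPzRing.Build endo
  endo_addA endo_addC endo_add0 endo_addN endo_mulA endo_mul1 endo_mulr1
  endo_mulDl endo_mulDr.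

Fact endo_scaleA a b f : endo_scale a (endo_scale b f) = endo_scale (a * b) f.
Proof. by apply: endoP => x /=; rewrite scalerA. Qed.
Fact endo_scale1 : left_id 1 endo_scale.
Proof. by move=> f; apply: endoP => x /=; rewrite scale1r. Qed.
Fact endo_scaleDr : right_distributive endo_scale +%R.
Proof. by move=> c f g; apply: endoP => x /=; rewrite scalerDr. Qed.
Fact endo_scaleDl f : {morph endo_scale^~ f : a b / a + b}.
Proof. by move=> a b; apply: endoP => x /=; rewrite scalerDl. Qed.

HB.instance Definition _ := GRing.Zmodule_isLmodule.Build K endo
  endo_scaleA endo_scale1 endo_scaleDr endo_scaleDl.

Fact endo_scaleAl (c : K) (f g : endo) : c *: (f * g) = (c *: f) * g.
Proof. by apply: endoP. Qed.
Fact endo_scaleAr (c : K) (f g : endo) : c *: (f * g) = f * (c *: g).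
Proof. by apply: endoP => x /=; rewrite [RHS]fZ. Qed.

Fact endo_oner_neq0 : (1 : endo) != 0.
Proof.
apply/eqP => /(congr1 (fun f : endo => f 1)) /= h.
by have := oner_neq0 V; rewrite -[X in X != _]/(endo_fun endo_one 1) h eqxx.
Qed.

HB.instance Definition _ := GRing.PzSemiRing_isNonZero.Build endo
  endo_oner_neq0.
HB.instance Definition _ := GRing.Lmodule_isLalgebra.Build K endo endo_scaleAl.
HB.instance Definition _ := GRing.Lalgebra_isAlgebra.Build K endo endo_scaleAr.

End Endo.

(* -------------------------------------------------------------------- *)
Section Span.
Variables (K : comNzRingType) (V : lmodType K) (P : V -> Prop).

Inductive in_span : V -> Prop :=
  | in_span0 : in_span 0
  | in_spanZD k x v : P x -> in_span v -> in_span (k *: x + v).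

Definition span : {pred V} := fun v => `[< in_span v >].

Lemma spanP v : reflect (in_span v) (v \in span).
Proof. exact: asboolP. Qed.

Fact span_submod : submod_closed span.
Proof.
split=> [|k u v /spanP hu /spanP hv]; apply/spanP; first exact: in_span0.
elim: hu => [|c x w Px _ IH]; first by rewrite scaler0 add0r.
by rewrite scalerDr scalerA -addrA; apply: in_spanZD.
Qed.

HB.instance Definition _ :=
  GRing.isSubmodClosed.Build K V span span_submod.

Lemma span_gen x : P x -> x \in span.
Proof.
by move=> Px; apply/spanP; rewrite -[x]addr0 -[x]scale1r; apply: in_spanZD => //;
  exact: in_span0.
Qed.

Definition quotm := Quotient.quot span.
HB.instance Definition _ := GRing.Zmodule.on quotm.
HB.instance Definition _ := EqQuotient.on quotm.

Definition quotm_pi (v : V) : quotm := \pi_quotm v.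

Lemma quotm_eq u v : quotm_pi u = quotm_pi v <-> u - v \in span.
Proof. by rewrite Quotient.idealrBE; split=> /eqP. Qed.

Lemma quotm_piK (q : quotm) : quotm_pi (repr q) = q.
Proof. exact: reprK. Qed.

Lemma quotm_piD u v : quotm_pi (u + v) = quotm_pi u + quotm_pi v.
Proof. by rewrite /quotm_pi !piE. Qed.

Lemma quotm_pi0 : quotm_pi 0 = 0.
Proof. by rewrite /quotm_pi !piE. Qed.

Definition quotm_scale (k : K) (q : quotm) : quotm := quotm_pi (k *: repr q).

Lemma quotm_piZ k v : quotm_pi (k *: v) = quotm_scale k (quotm_pi v).
Proof.
apply/quotm_eq; rewrite -scalerBr; apply: rpredZ.
by apply/quotm_eq; rewrite quotm_piK.
Qed.

Fact quotm_scaleA a b q :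
  quotm_scale a (quotm_scale b q) = quotm_scale (a * b) q.
Proof. by rewrite -[q]quotm_piK -!quotm_piZ scalerA. Qed.
Fact quotm_scale1 : left_id 1 quotm_scale.
Proof. by move=> q; rewrite -[q]quotm_piK -!quotm_piZ scale1r. Qed.
Fact quotm_scaleDr : right_distributive quotm_scale +%R.
Proof.
move=> k p q; rewrite -[p]quotm_piK -[q]quotm_piK.
by rewrite -quotm_piD -!quotm_piZ scalerDr quotm_piD.
Qed.
Fact quotm_scaleDl q : {morph quotm_scale^~ q : a b / a + b}.
Proof.
by move=> a b; rewrite -[q]quotm_piK -!quotm_piZ scalerDl quotm_piD.
Qed.

HB.instance Definition _ := GRing.Zmodule_isLmodule.Build K quotm
  quotm_scaleA quotm_scale1 quotm_scaleDr quotm_scaleDl.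

Lemma quotm_pi_linear : linear quotm_pi.
Proof. by move=> k u v; rewrite quotm_piD quotm_piZ. Qed.

HB.instance Definition _ := GRing.isLinear.Build K V quotm *:%R quotm_pi
  quotm_pi_linear.

End Span.

(* -------------------------------------------------------------------- *)
Section MalgLift.
Variables (K : comNzRingType) (X : choiceType) (M : lmodType K) (h : X -> M).

Definition malg_lift (r : {malg K[X]}) : M := \sum_(x <- msupp r) r@_x *: h x.

Lemma malg_liftEw (d : {fset X}) r : (msupp r `<=` d)%fset ->
  malg_lift r = \sum_(x <- d) r@_x *: h x.
Proof.
move=> le_d; rewrite /malg_lift (big_fset_incl _ le_d) // => x _ /mcoeff_outdom ->.
by rewrite scale0r.
Qed.

Fact malg_lift_linear : linear malg_lift.
Proof.
move=> k r s.
pose d := (msupp r `|` msupp s)%fset.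
have le_d : (msupp (k *: r + s) `<=` d)%fset.
  apply: fsubset_trans (msuppD_le _ _) _; apply: fsetSU; exact: msuppZ_le.
rewrite (malg_liftEw le_d) (malg_liftEw (fsubsetUl _ _ : msupp r `<=` d)%fset).
rewrite (malg_liftEw (fsubsetUr _ _ : msupp s `<=` d)%fset).
rewrite scaler_sumr -big_split /=; apply: eq_bigr => x _.
by rewrite mcoeffD mcoeffZ scalerDl scalerA.
Qed.
HB.instance Definition _ := GRing.isLinear.Build K {malg K[X]} M *:%R malg_lift
  malg_lift_linear.

Lemma malg_liftU k x : malg_lift << k *g x >> = k *: h x.
Proof.
rewrite (malg_liftEw (msuppU_le (k := x))) big_seq_fset1.
by rewrite mcoeffUU.
Qed.

End MalgLift.

(* -------------------------------------------------------------------- *)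
Section Tensor.
Variable K : comNzRingType.

Definition bilinear2 (A B M : lmodType K) (beta : A -> B -> M) :=
  (forall a, linear (beta a)) /\ (forall b, linear (beta^~ b)).

Section Def.
Variables (A B : lmodType K).

Inductive tensor_rel : {malg K[(A * B)%type]} -> Prop :=
  | tensor_rell k a a' b :
      tensor_rel (<< (k *: a + a', b) >> - (k *: << (a, b) >> + << (a', b) >>))
  | tensor_relr k a b b' :
      tensor_rel (<< (a, k *: b + b') >> - (k *: << (a, b) >> + << (a, b') >>)).

Definition tensor := quotm tensor_rel.
HB.instance Definition _ := GRing.Lmodule.on tensor.

Definition tens (a : A) (b : B) : tensor := quotm_pi tensor_rel << (a, b) >>.

(* The linear map induced by [beta]; meaningful only for bilinear [beta]. *)
Definition tlift (M : lmodType K) (beta : A -> B -> M) (x : tensor) : M :=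
  malg_lift (fun p => beta p.1 p.2) (repr x).

Variables (M : lmodType K) (beta : A -> B -> M).
Hypothesis beta_bilinear : bilinear2 beta.

Lemma tlift_pi r :
  tlift beta (quotm_pi tensor_rel r) = malg_lift (fun p => beta p.1 p.2) r.
Proof.
apply/eqP; rewrite -subr_eq0 -raddfB /=; apply/eqP.
have /quotm_eq/spanP : quotm_pi tensor_rel (repr (quotm_pi tensor_rel r)) =
  quotm_pi tensor_rel r by rewrite quotm_piK.
elim=> [|k x v Px _ IH]; first by rewrite raddf0.
rewrite malg_lift_linear IH addr0; case: Px => [c a a' b|c a b b'];
  rewrite raddfB /= malg_lift_linear !malg_liftU !scale1r.
  by rewrite /= (beta_bilinear.2 b) subrr scaler0.
by rewrite /= (beta_bilinear.1 a) subrr scaler0.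
Qed.

Lemma tlift_linear : linear (tlift beta).
Proof.
move=> k x y; rewrite -[x]quotm_piK -[y]quotm_piK -quotm_pi_linear !tlift_pi.
exact: malg_lift_linear.
Qed.

HB.instance Definition _ := GRing.isLinear.Build K tensor M *:%R (tlift beta)
  tlift_linear.

Lemma tlift0 : tlift beta 0 = 0. Proof. exact: raddf0. Qed.

Lemma tliftE a b : tlift beta (tens a b) = beta a b.
Proof. by rewrite tlift_pi malg_liftU scale1r. Qed.

Lemma tens_bilinear : bilinear2 tens.
Proof.
split=> [a|b] k x y; rewrite /tens -quotm_pi_linear; apply/quotm_eq/span_gen.
  exact: tensor_relr.
exact: tensor_rell.
Qed.

Lemma tens_ind (P : tensor -> Prop) : P 0 ->
  (forall k a b x, P x -> P (k *: tens a b + x)) -> forall x, P x.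
Proof.
move=> P0 PD x; rewrite -[x]quotm_piK [repr x]monalgE.
elim: (msupp _ : seq _) => [|[a b] s IH]; first by rewrite big_nil quotm_pi0.
rewrite big_cons; have -> : << (repr x)@_(a, b) *g (a, b) >> =
  (repr x)@_(a, b) *: << (a, b) >> :> {malg K[(A * B)%type]}.
  by apply/malgP => p; rewrite mcoeffZ !mcoeffU mulrnAr mulr1.
by rewrite quotm_pi_linear; apply: PD.
Qed.

End Def.

Definition tmap (A B A' B' : lmodType K) (f : A -> A') (g : B -> B') :
  tensor A B -> tensor A' B' := tlift (fun a b => tens (f a) (g b)).

Definition tassoc (A B C : lmodType K) :
  tensor (tensor A B) C -> tensor A (tensor B C) :=
  tlift (fun x c => tlift (fun a b => tens a (tens b c)) x).

Definition tmul (A B : algType K) (x y : tensor A B) : tensor A B :=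
  tlift (fun a b => tlift (fun a' b' => tens (a * a') (b * b')) y) x.

Lemma scaleACA (V : lmodType K) (k c : K) (x y z t : V) :
  c *: (k *: x + y) + (k *: z + t) = k *: (c *: x + z) + (c *: y + t).
Proof. by rewrite !scalerDr !scalerA addrACA [k * c]mulrC. Qed.

Section Tmul.
Variables A B : algType K.

Let tensl k (a a' : A) (b : B) :
  tens (k *: a + a') b = k *: tens a b + tens a' b.
Proof. exact: (tens_bilinear A B).2. Qed.
Let tensr k (a : A) (b b' : B) :
  tens a (k *: b + b') = k *: tens a b + tens a b'.
Proof. exact: (tens_bilinear A B).1. Qed.

Let lmul (c : A) (d : B) : tensor A B -> tensor A B :=
  tlift (fun a b => tens (c * a) (d * b)).

Let lmul_bilin c d : bilinear2 (fun (a : A) (b : B) => tens (c * a) (d * b)).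
Proof.
split=> u k x y; first by rewrite mulrDr -scalerAr tensr.
by rewrite mulrDr -scalerAr tensl.
Qed.

Let lmulE c d a b : lmul c d (tens a b) = tens (c * a) (d * b).
Proof. exact: (tliftE (lmul_bilin c d)). Qed.
Let lmul0 c d : lmul c d 0 = 0. Proof. exact: (tlift0 (lmul_bilin c d)). Qed.
Let lmulP c d : linear (lmul c d).
Proof. exact: (tlift_linear (lmul_bilin c d)). Qed.

Lemma tmul_bilinear (y : tensor A B) :
  bilinear2 (fun a b => tlift (fun a' b' => tens (a * a') (b * b')) y).
Proof.
suff: bilinear2 (fun a b => lmul a b y) by [].
elim/tens_ind: y => [|c p q z [IHr IHl]]; first split=> u k v w /=.
- by rewrite !lmul0 scaler0 addr0.
- by rewrite !lmul0 scaler0 addr0.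
split=> u k v w /=.
  move: (IHr u k v w) => /= IHu; rewrite !lmulP !lmulE IHu mulrDl -scalerAl.
  by rewrite tensr; exact: scaleACA.
move: (IHl u k v w) => /= IHu; rewrite !lmulP !lmulE IHu mulrDl -scalerAl.
by rewrite tensl; exact: scaleACA.
Qed.

Lemma tmulE (a a' : A) (b b' : B) :
  tmul (tens a b) (tens a' b') = tens (a * a') (b * b').
Proof. by rewrite /tmul (tliftE (tmul_bilinear _)) -/(lmul a b _) lmulE. Qed.

End Tmul.
End Tensor.

(* -------------------------------------------------------------------- *)
Record hopf_structure (K : comNzRingType) (H : algType K) := HopfStructure {
  comul : {linear H -> tensor H H};
  counit : {lrmorphism H -> K^o};
  antipode : {linear H -> H};
  comul1 : comul 1 = tens 1 1;
  comulM : forall x y, comul (x * y) = tmul (comul x) (comul y);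
  comulA : forall x,
    tassoc (tmap comul idfun (comul x)) = tmap idfun comul (comul x);
  counitl : forall x, tlift (fun a b => (counit a : K) *: b) (comul x) = x;
  counitr : forall x, tlift (fun a b => (counit b : K) *: a) (comul x) = x;
  antipodel : forall x,
    tlift (fun a b => antipode a * b) (comul x) = (counit x : K) *: 1;
  antipoder : forall x,
    tlift (fun a b => a * antipode b) (comul x) = (counit x : K) *: 1
}.

Record is_hopf_hom (K : comNzRingType) (A B : algType K)
    (hA : hopf_structure A) (hB : hopf_structure B) (f : A -> B) : Prop := {
  hopf_hom_comul : forall x, comul hB (f x) = tmap f f (comul hA x);
  hopf_hom_counit : forall x, counit hB (f x) = counit hA x;
  hopf_hom_antipode : forall x, antipode hB (f x) = f (antipode hA x)
}.

Record hopf_primitive (K : comNzRingType) (H : algType K)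
    (h : hopf_structure H) (x : H) : Prop := {
  primitive_comul : comul h x = tens 1 x + tens x 1;
  primitive_antipode : antipode h x = - x;
  primitive_counit : counit h x = 0
}.

(* -------------------------------------------------------------------- *)
Section FreeAlg.
Variables (K : comNzRingType) (X : choiceType).

Definition falg := {malg K[{fmonom X}]}.
HB.instance Definition _ := GRing.Lalgebra.on falg.

Fact malg_scaleAr (M : monomType) (k : K) (u v : {malg K[M]}) :
  k *: (u * v) = u * (k *: v).
Proof.
apply/malgP => m; rewrite mcoeffZ !mcoeffMl mulr_sumr.
apply: eq_bigr => x _.
rewrite (big_fset_incl _ (msuppZ_le k v)).
  rewrite mulr_sumr; apply: eq_bigr => y _.
  by rewrite mcoeffZ mulrnAr mulrCA.
by move=> y _ /mcoeff_outdom ->; rewrite mulr0 mul0rn.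
Qed.
HB.instance Definition _ := GRing.Lalgebra_isAlgebra.Build K falg
  (@malg_scaleAr _).

Definition fgen (x : X) : falg := << fmu x >>.

Variables (B : algType K) (f : X -> B).

Definition falg_lift : falg -> B :=
  malg_lift (fun w : {fmonom X} => \prod_(x <- w) f x).
HB.instance Definition _ := GRing.Linear.on falg_lift.

Lemma falg_lift_gen x : falg_lift (fgen x) = f x.
Proof. by rewrite /falg_lift malg_liftU scale1r fmU big_seq1. Qed.

Fact falg_lift_monoid : monoid_morphism falg_lift.
Proof.
split=> [|u v]; first by rewrite /falg_lift malg_liftU scale1r fm1 big_nil.
rewrite malgME raddf_sum /=; under eq_bigr do rewrite raddf_sum /=.
rewrite [in RHS]/falg_lift /malg_lift mulr_suml; apply: eq_bigr => x _.
rewrite mulr_sumr; apply: eq_bigr => y _.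
by rewrite /falg_lift malg_liftU fmM big_cat /= -scalerAl -scalerAr scalerA.
Qed.
HB.instance Definition _ :=
  GRing.isMonoidMorphism.Build falg B falg_lift falg_lift_monoid.

End FreeAlg.

(* -------------------------------------------------------------------- *)
Section IdealQuotient.
Variables (K : comNzRingType) (F : algType K) (P : F -> Prop).

Definition ideal_gen (u : F) : Prop := exists a p b, P p /\ u = a * p * b.

Definition quota := quotm ideal_gen.
HB.instance Definition _ := GRing.Lmodule.on quota.

Definition quota_pi : F -> quota := @quotm_pi K F ideal_gen.

Lemma ideal_genMl c u : u \in span ideal_gen -> c * u \in span ideal_gen.
Proof.
move=> /spanP; elim=> [|k x v [a [p [b [Pp ->]]]] _ IH].
  by rewrite mulr0 rpred0.
rewrite mulrDr -scalerAr rpredD // rpredZ //; apply: span_gen.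
by exists (c * a), p, b; rewrite !mulrA.
Qed.

Lemma ideal_genMr c u : u \in span ideal_gen -> u * c \in span ideal_gen.
Proof.
move=> /spanP; elim=> [|k x v [a [p [b [Pp ->]]]] _ IH].
  by rewrite mul0r rpred0.
rewrite mulrDl -scalerAl rpredD // rpredZ //; apply: span_gen.
by exists a, p, (b * c); rewrite !mulrA.
Qed.

Definition quota_one : quota := quota_pi 1.
Definition quota_mul (p q : quota) : quota := quota_pi (repr p * repr q).

Lemma quota_piK q : quota_pi (repr q) = q. Proof. exact: quotm_piK. Qed.

Lemma quota_piM u v : quota_pi (u * v) = quota_mul (quota_pi u) (quota_pi v).
Proof.
apply/quotm_eq.
have e w : w - repr (quota_pi w) \in span ideal_gen.
  by apply/quotm_eq; rewrite quotm_piK.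
set u' := repr (quota_pi u); set v' := repr (quota_pi v).
have -> : u * v - u' * v' = (u - u') * v + u' * (v - v').
  by rewrite mulrBl mulrBr addrA subrK.
by apply: rpredD; [exact/ideal_genMr/e | exact/ideal_genMl/e].
Qed.

Lemma quota_piD u v : quota_pi (u + v) = quota_pi u + quota_pi v.
Proof. exact: quotm_piD. Qed.

Lemma quota_piZ k u : quota_pi (k *: u) = k *: quota_pi u.
Proof. exact: quotm_piZ. Qed.

Fact quota_mulA : associative quota_mul.
Proof.
move=> p q r; rewrite -[p]quota_piK -[q]quota_piK -[r]quota_piK.
by rewrite -!quota_piM mulrA.
Qed.
Fact quota_mul1 : left_id quota_one quota_mul.
Proof. by move=> p; rewrite -[p]quota_piK -quota_piM mul1r. Qed.
Fact quota_mulr1 : right_id quota_one quota_mul.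
Proof. by move=> p; rewrite -[p]quota_piK -quota_piM mulr1. Qed.
Fact quota_mulDl : left_distributive quota_mul +%R.
Proof.
move=> p q r; rewrite -[p]quota_piK -[q]quota_piK -[r]quota_piK.
by rewrite -quota_piD -!quota_piM -quota_piD mulrDl.
Qed.
Fact quota_mulDr : right_distributive quota_mul +%R.
Proof.
move=> p q r; rewrite -[p]quota_piK -[q]quota_piK -[r]quota_piK.
by rewrite -quota_piD -!quota_piM -quota_piD mulrDr.
Qed.
Fact quota_scaleAl k (p q : quota) :
  k *: quota_mul p q = quota_mul (k *: p) q.
Proof.
rewrite -[p]quota_piK -[q]quota_piK -quota_piZ -!quota_piM.
by rewrite -quota_piZ scalerAl.
Qed.
Fact quota_scaleAr k (p q : quota) :
  k *: quota_mul p q = quota_mul p (k *: q).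
Proof.
rewrite -[p]quota_piK -[q]quota_piK -quota_piZ -!quota_piM.
by rewrite -quota_piZ scalerAr.
Qed.

Section Lift.
Variables (B : algType K) (phi : {lrmorphism F -> B}).

Definition quota_lift (q : quota) : B := phi (repr q).

Hypothesis phi_P : forall p, P p -> phi p = 0.

Lemma quota_lift_pi u : quota_lift (quota_pi u) = phi u.
Proof.
apply/eqP; rewrite -subr_eq0 -raddfB /=; apply/eqP.
have /quotm_eq/spanP : quota_pi (repr (quota_pi u)) = quota_pi u.
  by rewrite quota_piK.
elim=> [|k x v [a [p [b [Pp ->]]]] _ IH]; first by rewrite raddf0.
by rewrite linearP /= IH !rmorphM /= (phi_P Pp) mulr0 mul0r scaler0 addr0.
Qed.

Lemma quota_lift_linear : linear quota_lift.
Proof.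
move=> k p q; rewrite -[p]quota_piK -[q]quota_piK.
by rewrite -quota_piZ -quota_piD !quota_lift_pi linearP.
Qed.

Lemma quota_liftM p q :
  quota_lift (quota_mul p q) = quota_lift p * quota_lift q.
Proof.
by rewrite -[p]quota_piK -[q]quota_piK -quota_piM !quota_lift_pi rmorphM.
Qed.

Lemma quota_lift1 : quota_lift quota_one = 1.
Proof. by rewrite quota_lift_pi rmorph1. Qed.

Lemma quota_one_neq0 : quota_one != 0.
Proof.
apply/eqP => e; move: quota_lift1; rewrite e -[0](@quotm_pi0 K F ideal_gen).
by rewrite [quota_lift _]quota_lift_pi raddf0 => /esym/eqP; rewrite oner_eq0.
Qed.

End Lift.

End IdealQuotient.

(* -------------------------------------------------------------------- *)
Section Envelope.
Variables (K : comNzRingType) (E : algType K) (L : {pred E}).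

Definition env_carrier : choiceType := {x : E | x \in L}.
Let gen (x : env_carrier) : falg K env_carrier := fgen K x.

(* For L a K-submodule of E stable under the commutator, [envalg] is the
   universal enveloping algebra of the Lie algebra L. *)
Inductive env_rel : falg K env_carrier -> Prop :=
  | env_rel_lin k x y z : val z = k *: val x + val y ->
      env_rel (gen z - (k *: gen x + gen y))
  | env_rel_bracket x y z : val z = val x * val y - val y * val x ->
      env_rel (gen z - (gen x * gen y - gen y * gen x)).

Definition envalg := quota env_rel.
HB.instance Definition _ := GRing.Lmodule.on envalg.

Fact lrmorph_lin (F B : algType K) (phi : {lrmorphism F -> B}) k x y z :
  phi (z - (k *: x + y)) = phi z - (k *: phi x + phi y).
Proof. by rewrite raddfB /= linearP. Qed.

Fact lrmorph_bracket (F B : algType K) (phi : {lrmorphism F -> B}) x y z :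
  phi (z - (x * y - y * x)) = phi z - (phi x * phi y - phi y * phi x).
Proof. by rewrite !raddfB /= !rmorphM. Qed.

Section Rel.
Variables (B : algType K) (f : env_carrier -> B).
Hypothesis f_lin : forall k x y z, val z = k *: val x + val y ->
  f z = k *: f x + f y.
Hypothesis f_bracket : forall x y z, val z = val x * val y - val y * val x ->
  f z = f x * f y - f y * f x.

Lemma falg_lift_env_rel p : env_rel p -> falg_lift f p = 0.
Proof.
case=> [k x y z h|x y z h].
  by rewrite (lrmorph_lin (falg_lift f)) /= !falg_lift_gen (f_lin h) subrr.
by rewrite (lrmorph_bracket (falg_lift f)) /= !falg_lift_gen (f_bracket h) subrr.
Qed.

End Rel.

Fact env_one_neq0 : quota_one env_rel != 0.
Proof.
apply: (@quota_one_neq0 _ _ _ K^o (falg_lift (fun=> 0))).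
by apply: falg_lift_env_rel => *; rewrite ?scaler0 ?mulr0 ?addr0 ?subr0.
Qed.

HB.instance Definition _ := GRing.Zmodule_isNzRing.Build envalg
  (@quota_mulA _ _ env_rel) (@quota_mul1 _ _ env_rel)
  (@quota_mulr1 _ _ env_rel) (@quota_mulDl _ _ env_rel)
  (@quota_mulDr _ _ env_rel) env_one_neq0.
HB.instance Definition _ := GRing.Lmodule_isLalgebra.Build K envalg
  (@quota_scaleAl _ _ env_rel).
HB.instance Definition _ := GRing.Lalgebra_isAlgebra.Build K envalg
  (@quota_scaleAr _ _ env_rel).

Definition env_gen (x : env_carrier) : envalg := quota_pi env_rel (gen x).

(* The unital subalgebra of E generated by L. *)
Inductive in_genalg : E -> Prop :=
  | in_genalg1 : in_genalg 1
  | in_genalg_gen x : x \in L -> in_genalg x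
  | in_genalgP k x y : in_genalg x -> in_genalg y -> in_genalg (k *: x + y)
  | in_genalgM x y : in_genalg x -> in_genalg y -> in_genalg (x * y).

Definition genalg_pred : {pred E} := fun x => `[< in_genalg x >].

Record genalg := Genalg { genalg_val :> E; _ : genalg_val \in genalg_pred }.
HB.instance Definition _ := [isSub for genalg_val].
HB.instance Definition _ := [Choice of genalg by <:].

Fact genalg_closed : GRing.subsemialg_closed genalg_pred.
Proof.
apply: GRing.subalg_closed_semi; split=> [|k x y|x y].
- exact/asboolP/in_genalg1.
- by move=> /asboolP hx /asboolP hy; apply/asboolP/in_genalgP.
- by move=> /asboolP hx /asboolP hy; apply/asboolP/in_genalgM.
Qed.
HB.instance Definition _ := GRing.SubChoice_isSubAlgebra.Build K E genalg_pred
  genalg genalg_closed.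

Fact env_carrier_genalg (x : env_carrier) : val x \in genalg_pred.
Proof. by apply/asboolP/in_genalg_gen/(valP x). Qed.

Definition genalg_gen (x : env_carrier) : genalg :=
  Genalg (env_carrier_genalg x).

(* The algebra morphism extending the inclusion of L. *)
Definition env_eval : envalg -> genalg := quota_lift (falg_lift genalg_gen).

Fact env_eval_rel p : env_rel p -> falg_lift genalg_gen p = 0.
Proof.
by apply: falg_lift_env_rel => [k x y z h|x y z h]; apply: val_inj; exact: h.
Qed.

Lemma env_evalE x : env_eval (env_gen x) = genalg_gen x.
Proof.
rewrite /env_eval (quota_lift_pi (phi := falg_lift genalg_gen) env_eval_rel).
exact: falg_lift_gen.
Qed.

Fact env_eval_linear : linear env_eval.
Proof. exact: (quota_lift_linear (phi := falg_lift genalg_gen) env_eval_rel). Qed.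
HB.instance Definition _ := GRing.isLinear.Build K envalg genalg *:%R env_eval
  env_eval_linear.

Fact env_eval_monoid : monoid_morphism env_eval.
Proof.
split; first exact: (quota_lift1 (phi := falg_lift genalg_gen) env_eval_rel).
exact: (quota_liftM (phi := falg_lift genalg_gen) env_eval_rel).
Qed.
HB.instance Definition _ :=
  GRing.isMonoidMorphism.Build envalg genalg env_eval env_eval_monoid.

End Envelope.

(* -------------------------------------------------------------------- *)
(* Monomials with finitely many factorizations m = p.1 * p.2, so that formal
   power series indexed by them can be multiplied. *)
HB.mixin Record hasFactors M of MonomialDef M := {
  factors : M -> seq (M * M);
  factors_uniq : forall m, uniq (factors m);
  mem_factors : forall m p, (p \in factors m) = (mmul p.1 p.2 == m)
}.
HB.structure Definition FactorMonomial := {M of hasFactors M & MonomialDef M}.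
Notation factorMonomType := FactorMonomial.type.
HB.structure Definition ComFactorMonomial :=
  {M of FactorMonomial M & ConomialDef M}.
Notation comFactorMonomType := ComFactorMonomial.type.

(* The monomials t^i of one formal parameter, encoded by their exponent. *)
Section NatMonomial.

Fact natmonom_eq0 (i j : nat) : (i + j)%N = 0%N -> i = 0%N /\ j = 0%N.
Proof. by case: i j => [|i] [|j]. Qed.

HB.instance Definition _ := Choice_isMonomialDef.Build nat
  addnA add0n addn0 natmonom_eq0.
HB.instance Definition _ := MonomialDef_isConomialDef.Build nat addnC.

Definition nat_factors (k : nat) : seq (nat * nat) :=
  [seq (i, k - i)%N | i <- iota 0 k.+1].

Fact nat_factors_uniq k : uniq (nat_factors k).
Proof. by rewrite map_inj_uniq ?iota_uniq // => i j []. Qed.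

Fact mem_nat_factors k p : (p \in nat_factors k) = (mmul p.1 p.2 == k).
Proof.
case: p => i j; rewrite -[mmul _ _]/(i + j)%N /=.
apply/mapP/eqP => [[l]|<-].
  by rewrite mem_iota ltnS => /= le_lk [-> ->]; rewrite subnKC.
by exists i; rewrite ?addKn // mem_iota ltnS leq_addr.
Qed.

HB.instance Definition _ := hasFactors.Build nat nat_factors_uniq
  mem_nat_factors.

End NatMonomial.

Section FreeMonomial.
Variable I : choiceType.

Definition fmonom_factors (m : {fmonom I}) : seq ({fmonom I} * {fmonom I}) :=
  [seq (FMonom (take i m), FMonom (drop i m)) | i <- iota 0 (size m).+1].

Fact fmonom_factors_uniq m : uniq (fmonom_factors m).
Proof.
rewrite map_inj_in_uniq ?iota_uniq // => i j.
rewrite !mem_iota !ltnS => /= le_i le_j [/(congr1 size) + _].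
by rewrite !size_takel.
Qed.

Fact mem_fmonom_factors m p : (p \in fmonom_factors m) = (mmul p.1 p.2 == m).
Proof.
case: p => u v /=; rewrite fmP fmM; apply/mapP/eqP => [[i _ [-> ->]]|e].
  by rewrite /= cat_take_drop.
exists (size u); first by rewrite mem_iota /= ltnS -e size_cat leq_addr.
by rewrite -e take_size_cat // drop_size_cat //; congr (_, _); exact/val_inj.
Qed.

HB.instance Definition _ := hasFactors.Build {fmonom I} fmonom_factors_uniq
  mem_fmonom_factors.

End FreeMonomial.

Section CommutativeMonomial.
Variable n : nat.

Definition cmonom_divisors (m : {cmonom 'I_n}) : seq {cmonom 'I_n} :=
  undup [seq [cmonom (f i : nat) | i in finsupp m]%M
        | f : {ffun 'I_n -> 'I_(mdeg m).+1}].

Definition cmonom_factors (m : {cmonom 'I_n}) :=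
  [seq p <- [seq (d, divcm m d) | d <- cmonom_divisors m] | mmul p.1 p.2 == m].

Fact cmonom_factors_uniq m : uniq (cmonom_factors m).
Proof.
by rewrite filter_uniq // map_inj_uniq ?undup_uniq // => d e [].
Qed.

Fact mem_cmonom_factors m p : (p \in cmonom_factors m) = (mmul p.1 p.2 == m).
Proof.
rewrite mem_filter; case: eqP => //= e; apply/mapP; exists p.1; last first.
  case: p e => u v /= <-; congr (_, _); apply/eqP/cmP => i.
  by rewrite divcmE cmM addKn.
rewrite mem_undup; apply/mapP.
have le_m i : (p.1 i <= m i)%N by rewrite -e cmM leq_addr.
have le_deg i : (p.1 i < (mdeg m).+1)%N.
  rewrite ltnS (leq_trans (le_m i)) // mdegE.
  case: mdomP => // hi; rewrite (big_fsetD1 i) //= ?leq_addr //.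
exists [ffun i => Ordinal (le_deg i)]; first by rewrite mem_enum.
apply/eqP/cmP => i; rewrite cmE fsfun_fun ffunE /=.
by case: (mdomP m i) (le_m i) => //; rewrite leqn0 => _ /eqP.
Qed.

HB.instance Definition _ := hasFactors.Build {cmonom 'I_n} cmonom_factors_uniq
  mem_cmonom_factors.

End CommutativeMonomial.

(* -------------------------------------------------------------------- *)
Definition series (M : factorMonomType) (R : nzRingType) := M -> R.

Section Series.
Variables (M : factorMonomType) (R : nzRingType).
Local Notation S := (series M R).

HB.instance Definition _ := gen_eqMixin S.
HB.instance Definition _ := gen_choiceMixin S.

Definition ser_zero : S := fun=> 0.
Definition ser_one : S := fun m => (m == mone)%:R.
Definition ser_opp (u : S) : S := fun m => - u m.
Definition ser_add (u v : S) : S := fun m => u m + v m.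
Definition ser_mul (u v : S) : S := fun m => \sum_(p <- factors m) u p.1 * v p.2.
Definition ser_scale (c : R) (u : S) : S := fun m => c * u m.

Fact ser_addA : associative ser_add.
Proof. by move=> u v w; apply/funext => m; exact: addrA. Qed.
Fact ser_addC : commutative ser_add.
Proof. by move=> u v; apply/funext => m; exact: addrC. Qed.
Fact ser_add0 : left_id ser_zero ser_add.
Proof. by move=> u; apply/funext => m; exact: add0r. Qed.
Fact ser_addN : left_inverse ser_zero ser_opp ser_add.
Proof. by move=> u; apply/funext => m; exact: addNr. Qed.

Fact ser_mulDl : left_distributive ser_mul ser_add.
Proof.
move=> u v w; apply/funext => m; rewrite /ser_add /ser_mul -big_split /=.
by apply: eq_bigr => p _; rewrite mulrDl.
Qed.
Fact ser_mulDr : right_distributive ser_mul ser_add.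
Proof.
move=> u v w; apply/funext => m; rewrite /ser_add /ser_mul -big_split /=.
by apply: eq_bigr => p _; rewrite mulrDr.
Qed.

Fact ser_mul1 : left_id ser_one ser_mul.
Proof.
move=> u; apply/funext => m; rewrite /ser_mul /ser_one.
rewrite (bigD1_seq (mone, m)) ?factors_uniq ?mem_factors ?mul1m //=.
rewrite eqxx mul1r big_seq_cond big1 ?addr0 // => -[a b] /=.
rewrite mem_factors /= => /andP[/eqP <- ne]; case: (eqVneq a mone) ne => [->|_ _].
  by rewrite mul1m eqxx.
by rewrite mul0r.
Qed.
Fact ser_mulr1 : right_id ser_one ser_mul.
Proof.
move=> u; apply/funext => m; rewrite /ser_mul /ser_one.
rewrite (bigD1_seq (m, mone)) ?factors_uniq ?mem_factors ?mulm1 //=.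
rewrite eqxx mulr1 big_seq_cond big1 ?addr0 // => -[a b] /=.
rewrite mem_factors /= => /andP[/eqP <- ne]; case: (eqVneq b mone) ne => [->|_ _].
  by rewrite mulm1 eqxx.
by rewrite mulr0.
Qed.

Fact ser_mulA : associative ser_mul.
Proof.
move=> u v w; apply/funext => m; rewrite /ser_mul.
under eq_bigr do rewrite big_distrr /=.
under [RHS]eq_bigr do rewrite big_distrl /=.
pose F (t : M * M * M) := u t.1.1 * v t.1.2 * w t.2.
pose l1 := [seq (p.1, q.1, q.2) | p <- factors m, q <- factors p.2].
pose l2 := [seq (q.1, q.2, p.2) | p <- factors m, q <- factors p.1].
have -> : \sum_(p <- factors m) \sum_(q <- factors p.2)
    u p.1 * (v q.1 * w q.2) = \sum_(t <- l1) F t.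
  rewrite big_allpairs_dep; apply: eq_bigr => p _; apply: eq_bigr => q _.
  by rewrite mulrA.
have -> : \sum_(p <- factors m) \sum_(q <- factors p.1)
    u q.1 * v q.2 * w p.2 = \sum_(t <- l2) F t.
  by rewrite big_allpairs_dep.
apply: perm_big; apply: uniq_perm.
- apply: allpairs_uniq_dep; first exact: factors_uniq.
    by move=> p _; exact: factors_uniq.
  move=> s s' /allpairsPdep[[a b] [[c d] [_ + ->]]].
  move=> + /allpairsPdep[[a' b'] [[c' d'] [_ + ->]]].
  by rewrite !mem_factors /= => /eqP <- /eqP <- [-> -> ->].
- apply: allpairs_uniq_dep; first exact: factors_uniq.
    by move=> p _; exact: factors_uniq.
  move=> s s' /allpairsPdep[[a b] [[c d] [_ + ->]]].
  move=> + /allpairsPdep[[a' b'] [[c' d'] [_ + ->]]].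
  by rewrite !mem_factors /= => /eqP <- /eqP <- [-> -> ->].
- move=> [[a b] c]; apply/allpairsPdep/allpairsPdep.
    move=> [[x y] [[z t] [+ + [-> -> ->]]]].
    rewrite !mem_factors /= => /eqP <- /eqP <-.
    by exists (mmul x z, t), (x, z); rewrite !mem_factors /= mulmA !eqxx.
  move=> [[x y] [[z t] [+ + [-> -> ->]]]].
  rewrite !mem_factors /= => /eqP <- /eqP <-.
  by exists (z, mmul t y), (t, y); rewrite !mem_factors /= mulmA !eqxx.
Qed.

Fact ser_one_neq0 : ser_one != ser_zero.
Proof.
apply/eqP => /(congr1 (fun u : S => u mone)); rewrite /ser_one /ser_zero eqxx.
by move/eqP; rewrite oner_eq0.
Qed.

HB.instance Definition _ := GRing.isZmodule.Build S
  ser_addA ser_addC ser_add0 ser_addN.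
HB.instance Definition _ := GRing.Zmodule_isNzRing.Build S
  ser_mulA ser_mul1 ser_mulr1 ser_mulDl ser_mulDr ser_one_neq0.

Fact ser_scaleA a b u : ser_scale a (ser_scale b u) = ser_scale (a * b) u.
Proof. by apply/funext => m; rewrite /ser_scale mulrA. Qed.
Fact ser_scale1 : left_id 1 ser_scale.
Proof. by move=> u; apply/funext => m; rewrite /ser_scale mul1r. Qed.
Fact ser_scaleDr : right_distributive ser_scale +%R.
Proof. by move=> c u v; apply/funext => m; exact: mulrDr. Qed.
Fact ser_scaleDl u : {morph ser_scale^~ u : a b / a + b}.
Proof. by move=> a b; apply/funext => m; exact: mulrDl. Qed.
HB.instance Definition _ := GRing.Zmodule_isLmodule.Build R S
  ser_scaleA ser_scale1 ser_scaleDr ser_scaleDl.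

Fact ser_scaleAl c (u v : S) : c *: (u * v) = (c *: u) * v.
Proof.
apply/funext => m; rewrite -[LHS]/(c * \sum_(p <- factors m) _).
by rewrite mulr_sumr; apply: eq_bigr => p _; rewrite mulrA.
Qed.
HB.instance Definition _ := GRing.Lmodule_isLalgebra.Build R S ser_scaleAl.

End Series.

Section ComSeries.
Variables (M : factorMonomType) (R : comNzRingType).

Fact ser_scaleAr c (u v : series M R) : c *: (u * v) = u * (c *: v).
Proof.
apply/funext => m; rewrite -[LHS]/(c * \sum_(p <- factors m) _).
by rewrite mulr_sumr; apply: eq_bigr => p _; rewrite mulrCA.
Qed.
HB.instance Definition _ :=
  GRing.Lalgebra_isAlgebra.Build R (series M R) ser_scaleAr.

End ComSeries.

Section ComMonomSeries.
Variables (M : comFactorMonomType) (R : comNzRingType).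

Fact ser_mulC (u v : series M R) : u * v = v * u.
Proof.
apply/funext => m; rewrite -[LHS]/(\sum_(p <- factors m) u p.1 * v p.2).
rewrite -[RHS]/(\sum_(p <- factors m) v p.1 * u p.2).
rewrite (perm_big [seq (p.2, p.1) | p <- factors m]) ?big_map.
  by apply: eq_bigr => p _; rewrite mulrC.
apply: uniq_perm => [||[a b]]; first exact: factors_uniq.
  by rewrite map_inj_uniq ?factors_uniq // => -[a b] [c d] [-> ->].
rewrite mem_factors mulmC; apply/idP/mapP => [e|[[c d] + [-> ->]]].
  by exists (b, a); rewrite ?mem_factors.
by rewrite mem_factors.
Qed.
HB.instance Definition _ :=
  GRing.PzRing_hasCommutativeMul.Build (series M R) ser_mulC.

End ComMonomSeries.

Notation tseries := (series nat).

(* -------------------------------------------------------------------- *)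
Section TSeries.
Variable R : nzRingType.

Definition tneg (u : tseries R) : tseries R := fun j => (-1) ^+ j * u j.
Definition tderiv (u : tseries R) : tseries R := fun j => u j.+1 *+ j.+1.

(* A 5-tuple (f(t), g(t), d(t), h(t), m(t)), and the coefficients named as for
   noncommutative symmetric functions:
   f = \sum t^m Lambda_m, g = \sum t^m S_m, d = \sum t^m Phi_m / m,
   h = \sum t^(m-1) Psi_m, m = \sum t^(m-1) Xi_m. *)
Record tuple5 := Tuple5 {
  tup_f : tseries R; tup_g : tseries R; tup_d : tseries R;
  tup_h : tseries R; tup_m : tseries R
}.
Definition Lambda_ (X : tuple5) (m : nat) : R := tup_f X m.
Definition S_ (X : tuple5) (m : nat) : R := tup_g X m.
Definition Phi_ (X : tuple5) (m : nat) : R := tup_d X m *+ m.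
Definition Psi_ (X : tuple5) (m : nat) : R := tup_h X m.-1.
Definition Xi_ (X : tuple5) (m : nat) : R := tup_m X m.-1.

End TSeries.

Definition tcoef_map (R R' : nzRingType) (phi : R -> R') (u : tseries R) :
  tseries R' := fun j => phi (u j).

Definition tuple5_map (R R' : nzRingType) (phi : R -> R') (X : tuple5 R) :
  tuple5 R' :=
  Tuple5 (tcoef_map phi (tup_f X)) (tcoef_map phi (tup_g X))
    (tcoef_map phi (tup_d X)) (tcoef_map phi (tup_h X))
    (tcoef_map phi (tup_m X)).

(* e^u for a series u without constant term: the coefficient of t^j then only
   involves the powers u^k with k <= j. *)
Definition texp (K : comAlgType rat) (R : algType K) (u : tseries R) :
  tseries R :=
  fun j => \sum_(k < j.+1) ((k`!%:R^-1 : rat)%:A : K) *: (u ^+ k) j.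

(* -------------------------------------------------------------------- *)
(* The generator Lambda_(m+1) is indexed by m. *)
Definition NSym (K : comNzRingType) : algType K := falg K nat.

Record is_universal_tuple (K : comAlgType rat) (P : tuple5 (NSym K)) : Prop := {
  univ_f0 : tup_f P 0%N = 1;
  univ_fS : forall m, tup_f P m.+1 = fgen K m;
  univ_fg : tneg (tup_f P) * tup_g P = 1;
  univ_gf : tup_g P * tneg (tup_f P) = 1;
  univ_d0 : tup_d P 0%N = 0;
  univ_d : texp (tup_d P) = tup_g P;
  univ_h : tderiv (tup_g P) = tup_g P * tup_h P;
  univ_m : tderiv (tup_g P) = tup_m P * tup_g P
}.

(* -------------------------------------------------------------------- *)
Inductive variables := Commutative | Noncommutative.

Definition monom (v : variables) (n : nat) : factorMonomType :=
  match v with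
  | Commutative => {cmonom 'I_n}
  | Noncommutative => {fmonom 'I_n}
  end.

Definition mvar (v : variables) (n : nat) : 'I_n -> monom v n :=
  match v return 'I_n -> monom v n with
  | Commutative => @ucm 'I_n
  | Noncommutative => @fmu 'I_n
  end.

Definition mdegree (v : variables) (n : nat) : monom v n -> nat :=
  match v return monom v n -> nat with
  | Commutative => @mdeg 'I_n
  | Noncommutative => @fdeg 'I_n
  end.

Section DiffOp.
Variables (K : comAlgType rat) (v : variables) (n : nat).
Local Notation monom := (monom v n).

(* K<<z>> and K[[t]]<<z>>. *)
Definition zseries : algType K := series monom K.
Definition tzseries : algType (tseries K) := series monom (tseries K).

Definition zvar (R : nzRingType) (i : 'I_n) : series monom R :=
  fun m => (m == mvar v i)%:R.

Definition order_ge (R : nzRingType) (k : nat) (u : series monom R) :=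
  forall m, (mdegree m < k)%N -> u m = 0.

Definition tcoef (j : nat) (u : tzseries) : zseries := fun m => u m j.
Definition dt (u : tzseries) : tzseries := fun m => tderiv (u m).

Definition is_derivation (A : nzRingType) (delta : A -> A) :=
  forall x y, delta (x * y) = delta x * y + x * delta y.

Definition Der (alpha : nat) : {pred endo zseries} := fun delta =>
  `[< is_derivation delta /\ forall i, order_ge alpha (delta (zvar K i)) >].

Definition Dop (alpha : nat) : algType K := genalg (Der alpha).

(* The algebra generated by the derivations, identified with the enveloping
   algebra of Der through the surjection [env_eval : UDop alpha -> Dop alpha],
   carries the Hopf structure. It does not descend to Dop in general: for
   n = 1, alpha = 1 and d = d/dz, the element z^2d.z^2d - zd.z^3d + z^3d of
   UDop acts as 0, but its coproduct acts as
   2 z^2d (x) z^2d - zd (x) z^3d - z^3d (x) zd, which is not 0. *)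
Definition UDop (alpha : nat) : algType K := envalg (Der alpha).

(* K[[t]]-linear action of End_K(K<<z>>)[[t]] on K[[t]]<<z>>. *)
Definition tact (P : tseries (endo zseries)) (u : tzseries) : tzseries :=
  fun m j => \sum_(p <- factors j) P p.1 (tcoef p.2 u) m.

(* P = [u d/dz] *)
Definition is_vector_field (u : 'I_n -> tzseries)
    (P : tseries (endo zseries)) :=
  is_derivation (tact P) /\ forall i, tact P (zvar _ i) = u i.

(* The automorphism u |-> u(F_t) of K[[t]]<<z>>, where F_t(z) is the image of
   z, with inverse u |-> u(G_t). *)
Record tautomorphism (alpha : nat) := TAutomorphism {
  taut :> {lrmorphism tzseries -> tzseries};
  taut_inv : tzseries -> tzseries;
  tautK : cancel taut taut_inv;
  taut_invK : cancel taut_inv taut;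
  taut_order : forall i, order_ge alpha (zvar _ i - taut (zvar _ i));
  taut_t0 : forall i, tcoef 0 (zvar _ i - taut (zvar _ i)) = 0
}.

Section Omega.
Variables (alpha : nat) (F : tautomorphism alpha).

Definition Ht (i : 'I_n) : tzseries := zvar _ i - F (zvar _ i).
Definition Mt (i : 'I_n) : tzseries := taut_inv F (zvar _ i) - zvar _ i.

Definition tops (P : tseries (Dop alpha)) : tseries (endo zseries) :=
  tcoef_map (@genalg_val _ _ (Der alpha)) P.

(* D = [a d/dz] for a the D-Log of F. *)
Definition is_dlog_field (a : 'I_n -> tzseries) (D : tseries (endo zseries)) :=
  [/\ forall i, tcoef 0 (a i) = 0,
      forall i, order_ge alpha (a i),
      is_vector_field a D
    & forall i, tact (texp D) (zvar _ i) = F (zvar _ i)].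

Record is_Omega (X : tuple5 (Dop alpha)) : Prop := {
  Omega_f0 : tup_f X 0%N = 1;
  Omega_f : forall u, tact (tops (tneg (tup_f X))) u = F u;
  Omega_g0 : tup_g X 0%N = 1;
  Omega_g : forall u, tact (tops (tup_g X)) u = taut_inv F u;
  Omega_d : exists a D, is_dlog_field a D /\ tops (tup_d X) = - D;
  Omega_h : is_vector_field (fun i => F (dt (Mt i))) (tops (tup_h X));
  Omega_m : is_vector_field (fun i => taut_inv F (dt (Ht i))) (tops (tup_m X))
}.

End Omega.
End DiffOp.

Arguments Der : clear implicits.

(* Main.v *)
Require Import Defs.
From HB Require Import structures.
From mathcomp Require Import all_boot all_order all_algebra.
From mathcomp Require Import boolp finmap monalg generic_quotient.

(* Every series in K<<z>> is c + sum_i z_i u_i, so derivations and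
   substitutions are determined by the images of the z_i, without any continuity
   assumption.  Hence, with F and G the substitutions of F_t and G_t and D the
   derivative in t, the vector fields h(t) and m(t) are F D G - D and D - G D F,
   which gives dg/dt = g h = m g; moreover e^(-d) is multiplicative and sends z
   to F_t, so e^(-d) = f(-t) and e^d = g.  These are the relations that determine
   Pi from the Psi_m.

   Over a Q-algebra the Psi_m generate NSym freely, so S can be defined by
   Psi_m |-> psi_m, an element of Der, and it is a Hopf morphism because these
   elements are primitive.  If S' is another one, S'(Psi_m) is a primitive
   element of the enveloping algebra acting as psi_m.  In the enveloping algebra
   every element is a combination of powers x^k with x in Der, on which
   u |-> u_(1) u_(2) acts as 2^k, so that primitive elements lie in Der, where
   the action is faithful. *)

Set Implicit Arguments.
Unset Strict Implicit.
Unset Printing Implicit Defensive.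
Import GRing.Theory.
Local Open Scope ring_scope.

(** * Power series in one parameter *)

Lemma sum_factors_nat (V : nmodType) (G : nat -> nat -> V) j :
  \sum_(p <- factors j) G p.1 p.2 = \sum_(i < j.+1) G i (j - i)%N.
Proof.
rewrite -[factors j]/(nat_factors j) /nat_factors big_map.
by rewrite -[iota 0 _]/(index_iota 0 j.+1) big_mkord.
Qed.

Lemma tserM (R : nzRingType) (u w : tseries R) j :
  (u * w) j = \sum_(i < j.+1) u i * w (j - i)%N.
Proof. exact: (sum_factors_nat (fun a b => u a * w b)). Qed.

Section SeriesCoef.
Variables (M : factorMonomType) (R : nzRingType).
Implicit Types u w : series M R.

Lemma serM u w m : (u * w) m = \sum_(p <- factors m) u p.1 * w p.2.
Proof. by []. Qed.

Lemma serD u w m : (u + w) m = u m + w m. Proof. by []. Qed.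
Lemma serN u m : (- u) m = - u m. Proof. by []. Qed.
Lemma ser0 m : (0 : series M R) m = 0. Proof. by []. Qed.
Lemma ser1 m : (1 : series M R) m = (m == mone)%:R. Proof. by []. Qed.
Lemma serZ (c : R) u m : (c *: u) m = c * u m. Proof. by []. Qed.

Lemma ser_sum (I : Type) (r : seq I) (P : pred I) (G : I -> series M R) m :
  (\sum_(i <- r | P i) G i) m = \sum_(i <- r | P i) G i m.
Proof. by elim/big_rec2: _ => // i x u _ <-. Qed.

Lemma serMn u k m : (u *+ k) m = u m *+ k.
Proof. by elim: k => // k IH; rewrite !mulrS serD IH. Qed.

End SeriesCoef.

Lemma tserM0 (R : nzRingType) (u w : tseries R) : (u * w) 0%N = u 0%N * w 0%N.
Proof. by rewrite tserM big_ord1. Qed.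

Section RationalScalars.
Variables (K : comAlgType rat) (V : lmodType K).
Implicit Types x y : V.

Lemma ratA_nat j : (j%:R : rat)%:A = j%:R :> K.
Proof. by rewrite scaler_nat. Qed.

Lemma ratA_unit (q : rat) : q != 0 -> q%:A * (q^-1)%:A = 1 :> K.
Proof. by move=> q0; rewrite -scalerAl mul1r scalerA divff // scale1r. Qed.

Lemma divnK j x : ((j.+1%:R^-1 : rat)%:A : K) *: x *+ j.+1 = x.
Proof.
rewrite -scaler_nat scalerA -ratA_nat ratA_unit ?scale1r //.
by rewrite Num.Theory.pnatr_eq0.
Qed.

(** Division by positive integers is available because the scalars contain the rationals. *)
Lemma mulrSn_inj j x y : x *+ j.+1 = y *+ j.+1 -> x = y.
Proof. by move=> e; rewrite -[x](divnK j) -[y](divnK j) !scalerMnr e. Qed.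

End RationalScalars.

(** * Fixed points and inverses by [t]-adic approximation *)

Section CausalMaps.
Variable R : nzRingType.
Implicit Types (u w : tseries R) (T : tseries R -> tseries R).

(** Congruence modulo [t^k]. The [causal] maps are the strict contractions for the [t]-adic
    distance. *)
Definition agree k u w := forall i, (i < k)%N -> u i = w i.
Definition causal T := forall u w k, agree k u w -> T u k = T w k.

(** A [t]-adic contraction principle: the iterates of [T] from 0 become stationary in each degree,
    and the fixed point is read off their diagonal. *)
Lemma causal_fix_exists T : causal T -> exists u, T u = u.
Proof.
move=> cT; pose a k := iter k T 0; exists (fun j => a j.+1 j).
have aS k : a k.+1 = T (a k) by [].
have stable k j : (j < k)%N -> a k j = a j.+1 j.
  elim/ltn_ind: k j => -[//|k] IH j; rewrite ltnS !aS => le_jk.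
  by apply: cT => i lt_ij; rewrite !IH // (leq_trans lt_ij).
apply/funext => j; rewrite aS; apply: cT => i lt_ij.
by rewrite [RHS]stable.
Qed.

Lemma agree_mul u u' w w' k : agree k u u' -> agree k w w' ->
  agree k (u * w) (u' * w').
Proof.
move=> eu ew j lt_jk; rewrite !tserM; apply: eq_bigr => i _.
by rewrite eu ?ew // ?(leq_ltn_trans _ lt_jk) ?leq_subr // -ltnS.
Qed.

Lemma tser_rinv_exists u : u 0%N = 1 -> exists w, u * w = 1.
Proof.
(* The geometric series as a fixed point; [T] is causal because [u - 1] has no constant term. *)
move=> u0; pose T w : tseries R := 1 - (u - 1) * w.
have [|w Tw] := @causal_fix_exists T.
  move=> w w' k e; rewrite /T !serD !serN !tserM; congr (_ - _).
  rewrite !big_ord_recl /= !subn0 !serD !serN u0 ser1 eqxx subrr !mul0r.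
  congr (_ + _); apply: eq_bigr => i _; rewrite /= e // /bump /=.
  by case: k {e} i => [[]//|k i]; rewrite subSS ltnS leq_subr.
exists w; rewrite -[u](subrK 1) mulrDl mul1r -{2}Tw /T.
by rewrite addrC subrK.
Qed.

End CausalMaps.

Section Tderiv.
Variable R : nzRingType.
Implicit Types u w : tseries R.

Lemma tderivD u w : tderiv (u + w) = tderiv u + tderiv w.
Proof. by apply/funext => j; rewrite /tderiv !serD mulrnDl. Qed.

Lemma tderivN u : tderiv (- u) = - tderiv u.
Proof. by apply/funext => j; rewrite /tderiv !serN mulNrn. Qed.

Lemma tderivM u w : tderiv (u * w) = tderiv u * w + u * tderiv w.
Proof.
apply/funext => j; rewrite /tderiv serD !tserM -sumrMnl.
rewrite (eq_bigr (fun i : 'I_j.+2 =>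
  u i * w (j.+1 - i)%N *+ i + u i * w (j.+1 - i)%N *+ (j.+1 - i))); last first.
  by move=> i _; rewrite -mulrnDr subnKC // -ltnS.
rewrite big_split /=; congr (_ + _).
  rewrite big_ord_recl /= mulr0n add0r; apply: eq_bigr => i _.
  by rewrite /bump /= add1n subSS mulrnAl.
rewrite big_ord_recr /= subnn mulr0n addr0; apply: eq_bigr => i _.
by rewrite subSn ?mulrnAr // -ltnS.
Qed.

End Tderiv.

(** Division by integers is also required in [tseries (tseries R)], whose scalars are series; this
    property passes to series coefficientwise. *)
Definition torsion_free (R : nzRingType) :=
  forall j (x y : R), x *+ j.+1 = y *+ j.+1 -> x = y.

Lemma torsion_free_alg (K : comAlgType rat) (R : algType K) : torsion_free R.
Proof. by move=> j x y; exact: (@mulrSn_inj K R). Qed.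

Lemma torsion_free_series (M : factorMonomType) (R : nzRingType) :
  torsion_free R -> torsion_free (series M R).
Proof.
move=> tfR j u w e; apply/funext => m; apply: (tfR j).
by rewrite -!serMn e.
Qed.

(* [T] does not increase the degree in [t], so [tderiv u = T u] determines
   each coefficient of [u] from the previous ones. *)
Lemma ode_unique (R : nzRingType) (T : tseries R -> tseries R)
    (u w : tseries R) :
    torsion_free R -> (forall a b k, agree k.+1 a b -> T a k = T b k) ->
  u 0%N = w 0%N -> tderiv u = T u -> tderiv w = T w -> u = w.
Proof.
move=> tfR cT e0 eu ew; apply/funext => j; elim/ltn_ind: j => -[//|j] IH.
apply: (tfR j); rewrite -[LHS]/(tderiv u j) -[RHS]/(tderiv w j).
by rewrite eu ew; apply: cT.
Qed.

Section LinearODE.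
Variables (K : comAlgType rat) (R : algType K).
Implicit Types u w h : tseries R.

Lemma oder_unique h u w : u 0%N = w 0%N ->
  tderiv u = u * h -> tderiv w = w * h -> u = w.
Proof.
move=> *; apply: (@ode_unique _ (fun a => a * h)) => //.
  exact: (@torsion_free_alg K).
by move=> a b k e; exact: (agree_mul e).
Qed.

(** The integrated equation, with initial value 1, is a causal fixed-point problem. *)
Lemma oder_exists h : exists2 u : tseries R, u 0%N = 1 & tderiv u = u * h.
Proof.
pose T u : tseries R := fun j =>
  if j is i.+1 then ((j%:R^-1 : rat)%:A : K) *: (u * h) i else 1.
have [|u Tu] := @causal_fix_exists _ T.
  move=> a b [//|k] e; rewrite /T; congr (_ *: _).
  exact: (agree_mul e (fun _ _ => erefl)).
exists u; first by rewrite -Tu.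
by apply/funext => j; rewrite /tderiv -{1}Tu /T divnK.
Qed.

End LinearODE.

(* A series in an auxiliary parameter [s] over the series in [t] whose
   coefficient of [s^k] is divisible by [t^k] can be evaluated at [s = 1]. *)
Section Evaluation.
Variable R : nzRingType.
Implicit Types W : tseries (tseries R).

Definition summable W := forall k j, (j < k)%N -> W k j = 0.
Definition ssum W : tseries R := fun j => \sum_(k < j.+1) W k j.

Lemma ssumE W N j : summable W -> (j <= N)%N ->
  ssum W j = \sum_(k < N.+1) W k j.
Proof.
move=> sW le_jN; rewrite /ssum (big_ord_widen N.+1 (fun k => W k j)) //.
rewrite big_mkcond; apply: eq_bigr => k _; case: ltnP => // lt_jk.
by rewrite sW.
Qed.

(** The substitution [b = k - a] turns the left side into a sum over the triangle [a + b < N], and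
    the square adds only zero terms to it. *)
Lemma sum_triangle (V : nmodType) (G : nat -> nat -> V) N :
    (forall a b, (N <= a + b)%N -> G a b = 0) ->
  \sum_(k < N) \sum_(a < k.+1) G a (k - a)%N = \sum_(a < N) \sum_(b < N) G a b.
Proof.
move=> G0; transitivity (\sum_(k < N) \sum_(a < N | (a <= k)%N) G a (k - a)%N).
  apply: eq_bigr => k _.
  by rewrite (big_ord_widen N (fun a => G a (k - a)%N)) // ltn_ord.
rewrite (exchange_big_dep xpredT) //=; apply: eq_bigr => a _.
rewrite -(big_mkord (fun k => a <= k)%N (fun k => G a (k - a)%N)).
rewrite -(big_mkord xpredT (G a)).
rewrite (@big_cat_nat _ _ _ a) ?(ltnW (ltn_ord a)) //=.
rewrite big_nat_cond big_pred0 ?add0r; last first.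
  by move=> k /=; case: ltnP => //= lt_ka; rewrite leqNgt lt_ka.
rewrite (@big_cat_nat _ _ _ (N - a)%N 0 N) ?leq_subr //=.
rewrite [X in _ = _ + X]big_nat_cond [X in _ = _ + X]big1 ?addr0; last first.
  by move=> b /andP[/andP[h _] _]; apply: G0; rewrite -leq_subLR.
rewrite -{1}[nat_of_ord a]add0n big_addn big_nat_cond [RHS]big_nat_cond.
by apply: eq_big => [b|b _]; rewrite ?leq_addl ?addnK.
Qed.

Lemma ssumM W W' : summable W -> summable W' ->
  ssum (W * W') = ssum W * ssum W'.
Proof.
move=> sW sW'; apply/funext => j; rewrite [LHS]/ssum.
transitivity (\sum_(k < j.+1) \sum_(a < k.+1) (W a * W' (k - a)%N) j).
  by apply: eq_bigr => k _; rewrite tserM ser_sum.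
(* Here [W a] is divisible by [t^a] and [W' b] by [t^b], so the terms with [a + b > j] do not reach
   the coefficient of [t^j]. *)
rewrite (sum_triangle (G := fun a b => (W a * W' b) j)); last first.
  move=> a b lt_jab; rewrite tserM big1 // => i _.
  case: (ltnP i a) => [/sW ->|le_ai]; first by rewrite mul0r.
  have le_ij : (i <= j)%N by rewrite -ltnS.
  rewrite sW' ?mulr0 // -(ltn_add2l i) subnKC //.
  by rewrite (leq_trans lt_jab) // leq_add2r.
rewrite tserM; under [RHS]eq_bigr => i _.
  rewrite (ssumE sW (N := j)) ?(ltnSE (ltn_ord i)) //.
  rewrite (ssumE sW' (N := j)) ?leq_subr // mulr_suml.
  over.
rewrite [RHS]exchange_big; apply: eq_bigr => a _ /=.
under [RHS]eq_bigr do rewrite mulr_sumr.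
by rewrite [RHS]exchange_big; apply: eq_bigr => b _; rewrite tserM.
Qed.

End Evaluation.

(** * Exponentials of series without constant term *)

Lemma tserX_eq0 (R : nzRingType) (u : tseries R) k j :
  u 0%N = 0 -> (j < k)%N -> (u ^+ k) j = 0.
Proof.
move=> u0; elim: k j => // k IH j; rewrite ltnS => le_jk.
rewrite exprS tserM big1 // => -[[|i] lt_ij] _ /=; first by rewrite u0 mul0r.
rewrite IH ?mulr0 // (leq_trans _ le_jk) // ltn_subrL /=.
by case: j lt_ij {le_jk}.
Qed.

Section Exponential.
Variables (K : comAlgType rat) (R : algType K).
Implicit Types u w : tseries R.

(** This is [e^(s u)] as a series in the auxiliary parameter [s]; its value at [s = 1] is
    [texp u]. *)
Definition eser u : tseries (tseries R) :=
  fun k j => ((k`!%:R^-1 : rat)%:A : K) *: (u ^+ k) j.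

Lemma eser_summable u : u 0%N = 0 -> summable (eser u).
Proof. by move=> u0 k j lt; rewrite /eser tserX_eq0 ?scaler0. Qed.

Lemma eser0 u : eser u 0%N = 1.
Proof.
apply/funext => j; rewrite /eser expr0.
by rewrite fact0 invr1 scale1r scale1r.
Qed.

Lemma invfactS k : (k.+1`!%:R^-1 : rat)%:A *+ k.+1 = (k`!%:R^-1 : rat)%:A :> K.
Proof.
rewrite scalerMnl factS natrM invfM -[_ *+ _]mulr_natr mulrAC mulVf ?mul1r //.
by rewrite Num.Theory.pnatr_eq0.
Qed.

Lemma tderiv_eser u : tderiv (eser u) = u *: eser u.
Proof.
apply/funext => k; rewrite serZ; apply/funext => j.
rewrite /tderiv serMn /eser -[LHS]scaler_nat.
rewrite -[LHS]/(_%:R *: (_ *: (u ^+ k.+1) j)) scalerA mulr_natl invfactS.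
rewrite exprS !tserM scaler_sumr; apply: eq_bigr => i _.
by rewrite scalerAr.
Qed.

Lemma texp_ssum u : texp u = ssum (eser u). Proof. by []. Qed.

Lemma texpN u : u 0%N = 0 -> texp u * texp (- u) = 1.
Proof.
move=> u0; have Nu0 : (- u) 0%N = 0 by rewrite serN u0 oppr0.
rewrite !texp_ssum -ssumM; do ?exact: eser_summable.
have -> : eser u * eser (- u) = 1.
  (* The product [e^(s u) e^(-s u)] has derivative 0 in [s] and constant term 1. *)
  apply: (@ode_unique _ (fun=> 0)) => //.
  - by apply: torsion_free_series; exact: (@torsion_free_alg K).
  - by rewrite tserM0 !eser0 mulr1.
  - rewrite tderivM !tderiv_eser -scalerAl.
    have -> : eser u * (- u *: eser (- u)) = - (u *: (eser u * eser (- u))).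
      apply/funext => k; rewrite serN serZ !tserM mulr_sumr -sumrN.
      apply: eq_bigr => i _; rewrite serZ mulNr mulrN; congr (- _).
      (* What remains is that [u] commutes with its own powers. *)
      rewrite !mulrA; congr (_ * _).
      apply/funext => j; rewrite /eser tserM.
      rewrite (eq_bigr (fun a : 'I_j.+1 =>
        ((i`!%:R^-1 : rat)%:A : K) *: ((u ^+ i) a * u (j - a)%N))).
        rewrite -scaler_sumr -tserM -exprSr exprS !tserM scaler_sumr.
        by apply: eq_bigr => a _; rewrite scalerAr.
      by move=> a _; rewrite scalerAl.
    by rewrite subrr.
  - by apply/funext => j; rewrite /tderiv ser1 mul0rn.
apply/funext => j; rewrite /ssum big_ord_recl big1 ?addr0 //.
Qed.

Lemma agree_exp u w k j : agree j u w -> agree j (u ^+ k) (w ^+ k).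
Proof.
by move=> e; elim: k => [|k IH] //; rewrite !exprS; exact: agree_mul.
Qed.

(** The coefficient of [t^(j+1)] in [texp u] is [u j.+1] plus a contribution of the powers [u^k],
    [k >= 2], which involves only lower coefficients of [u]. *)
Lemma texp_inj u w : u 0%N = 0 -> w 0%N = 0 -> texp u = texp w -> u = w.
Proof.
move=> u0 w0 e; apply/funext => j; elim/ltn_ind: j => -[|j] IH.
  by rewrite u0 w0.
have texpS v : texp v j.+1 = eser v 0%N j.+1 +
    (v j.+1 + \sum_(i < j) eser v i.+2 j.+1).
  by rewrite texp_ssum /ssum !big_ord_recl /= {2}/eser invr1 !scale1r expr1.
move: (congr1 (fun a : tseries R => a j.+1) e); rewrite !texpS !eser0 => /addrI.
have -> : \sum_(i < j) eser u i.+2 j.+1 = \sum_(i < j) eser w i.+2 j.+1.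
  apply: eq_bigr => i _; rewrite /eser; congr (_ *: _).
  rewrite exprS (exprS w) !tserM.
  apply: eq_bigr => -[[|a] lt_aj] _ /=; first by rewrite u0 w0 !mul0r.
  (* The top coefficient of index [j.+1] is not covered by [IH], but its cofactor is the constant
     term of a positive power, hence 0. *)
  rewrite (agree_exp _ IH) ?ltn_subrL //; move: lt_aj; rewrite ltnS leq_eqVlt.
  case/orP => [/eqP ->|/IH -> //]; rewrite subnn !exprS !tserM0.
  by rewrite w0 mul0r !mulr0.
exact: addIr.
Qed.

End Exponential.

(** * Series of endomorphisms and their action *)

Section EndoCoef.
Variables (K : comNzRingType) (V : lalgType K).
Implicit Types f g : endo V.

HB.instance Definition _ f := GRing.isLinear.Build K V V *:%R (endo_fun f)
  (endo_linear f).

Lemma endo_mulE f g x : (f * g) x = f (g x). Proof. by []. Qed.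
Lemma endo_addE f g x : (f + g) x = f x + g x. Proof. by []. Qed.
Lemma endo_scaleE k f x : (k *: f) x = k *: f x. Proof. by []. Qed.
Lemma endo0E x : (0 : endo V) x = 0. Proof. by []. Qed.
Lemma endo1E x : (1 : endo V) x = x. Proof. by []. Qed.
Lemma endo_sumE (I : Type) (r : seq I) (P : pred I) (G : I -> endo V) x :
  (\sum_(i <- r | P i) G i) x = \sum_(i <- r | P i) G i x.
Proof. by elim/big_rec2: _ => // i f y _ <-. Qed.

Lemma endo_mulrnE f k x : (f *+ k) x = f x *+ k.
Proof. by elim: k => // k IH; rewrite !mulrS endo_addE IH. Qed.
End EndoCoef.

Section Action.
Variables (K : comNzRingType) (V : lalgType K).
Implicit Types (P Q : tseries (endo V)) (w : tseries V).

(** The counterpart of [tact] on [K<<z>>[[t]]], where the powers of [t] are outermost and the action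
    is a Cauchy product. *)
Definition act P w : tseries V := fun j => \sum_(p <- factors j) P p.1 (w p.2).

Lemma actE P w j : act P w j = \sum_(i < j.+1) P i (w (j - i)%N).
Proof. exact: (sum_factors_nat (fun a b => P a (w b))). Qed.

Fact rconst_linear (x : V) : linear (fun y : V => y * x).
Proof. by move=> k y z; rewrite mulrDl scalerAl. Qed.

(* [y |-> y * w_j] maps [1] to [w_j], so that [act] becomes the product of
   series with coefficients in [endo V], evaluated at [1]. *)
Lemma act_mul P Q w : act (P * Q) w = act P (act Q w).
Proof.
pose Y : tseries (endo V) := fun j => Endo (rconst_linear (w j)).
have actY P' : act P' w = fun j => (P' * Y) j 1.
  apply/funext => j; rewrite actE tserM endo_sumE; apply: eq_bigr => i _.
  by rewrite endo_mulE /= mul1r.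
rewrite !actY; apply/funext => j; rewrite -mulrA actE tserM endo_sumE.
by apply: eq_bigr => i _; rewrite endo_mulE.
Qed.

Lemma act1 w : act 1 w = w.
Proof.
apply/funext => j; rewrite actE big_ord_recl ser1 eqxx endo1E subn0.
by rewrite big1 ?addr0 // => i _; rewrite ser1 endo0E.
Qed.

Lemma actDr P w w' : act P (w + w') = act P w + act P w'.
Proof.
apply/funext => j; rewrite serD !actE -big_split; apply: eq_bigr => i _.
by rewrite serD raddfD.
Qed.

Lemma actDl P Q w : act (P + Q) w = act P w + act Q w.
Proof.
apply/funext => j; rewrite serD !actE -big_split; apply: eq_bigr => i _.
by rewrite serD.
Qed.

Lemma act0r P : act P 0 = 0.
Proof. by apply: (addrI (act P 0)); rewrite -actDr !addr0. Qed.

Definition tconst (x : V) : tseries V := fun j => if j is 0 then x else 0.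

Lemma act_tconst P x j : act P (tconst x) j = P j x.
Proof.
rewrite actE big_ord_recr /= subnn /= big1 ?add0r // => i _.
by move: (subn_gt0 i j); rewrite ltn_ord; case: (j - i)%N => // l;
  rewrite raddf0.
Qed.

Lemma tconstM x y : tconst (x * y) = tconst x * tconst y.
Proof.
apply/funext => j; rewrite tserM big_ord_recl /= subn0 big1 ?addr0.
  by case: j => //= j; rewrite mulr0.
by move=> i _; rewrite mul0r.
Qed.

Lemma act_inj P Q : (forall x, act P (tconst x) = act Q (tconst x)) -> P = Q.
Proof.
move=> e; apply/funext => j; apply: endoP => x.
by rewrite -!act_tconst e.
Qed.

Lemma tconstMl (w : tseries V) y j : (w * tconst y) j = w j * y.
Proof.
rewrite tserM big_ord_recr /= subnn /= big1 ?add0r // => i _.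
by move: (subn_gt0 i j); rewrite ltn_ord; case: (j - i)%N => // l;
  rewrite mulr0.
Qed.

Lemma tconstMr (w : tseries V) y j : (tconst y * w) j = y * w j.
Proof.
by rewrite tserM big_ord_recl /= subn0 big1 ?addr0 // => i _; rewrite mul0r.
Qed.

Lemma act_derivation_coef P : is_derivation (act P) ->
  forall j, is_derivation (P j).
Proof.
move=> dP j x y; rewrite -!act_tconst tconstM dP serD.
by rewrite tconstMl tconstMr.
Qed.

End Action.

(** * The exponential of a derivation is multiplicative *)

Section ExpDerivation.
Variables (K : comAlgType rat) (V : algType K) (P : tseries (endo V)).
Hypotheses (P0 : P 0%N = 0) (dP : is_derivation (act P)).

(** This is [e^(s P) w], as a series in [s]. *)
Let E (w : tseries V) : tseries (tseries V) := fun k => act (eser P k) w.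

Let E_summable w : summable (E w).
Proof.
move=> k j lt_jk; rewrite /E actE big1 // => i _.
rewrite eser_summable ?endo0E //; apply: leq_ltn_trans lt_jk.
by rewrite -ltnS.
Qed.

Let actE_texp w : act (texp P) w = ssum (E w).
Proof.
apply/funext => j; rewrite actE texp_ssum /ssum /E.
under [RHS]eq_bigr do rewrite actE.
rewrite exchange_big; apply: eq_bigr => i _ /=.
rewrite -/(ssum (eser P) i) (ssumE (N := j)) ?endo_sumE //.
  exact: eser_summable.
by rewrite -ltnS.
Qed.

Let tderiv_E w : tderiv (E w) = fun k => act P (E w k).
Proof.
apply/funext => k; rewrite /tderiv /E -act_mul.
have -> : P * eser P k = (P *: eser P) k by [].
rewrite -tderiv_eser /tderiv; apply/funext => j.
rewrite serMn !actE -sumrMnl; apply: eq_bigr => i _.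
by rewrite serMn endo_mulrnE.
Qed.

(* Both sides are values at [s = 1] of solutions of [dw/ds = P w], where [P] is
   a derivation, with the same initial value [x * y]. *)
Lemma texp_derivationM x y :
  act (texp P) (x * y) = act (texp P) x * act (texp P) y.
Proof.
rewrite !actE_texp -ssumM //; congr ssum.
apply: (@ode_unique _ (fun w k => act P (w k))).
- by apply: torsion_free_series; exact: (@torsion_free_alg K).
- by move=> a b k e; rewrite e.
- by rewrite tserM0 /E !eser0 !act1.
- exact: tderiv_E.
rewrite tderivM !tderiv_E; apply/funext => k; rewrite serD !tserM.
rewrite -big_split /=; under eq_bigr do rewrite -dP.
by elim/big_rec2: _ => [|i a b _ ->]; rewrite ?act0r ?actDr.
Qed.

End ExpDerivation.

(** * Order in [z] and automatic continuity *)

Section Monomials.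
Variables (v : variables) (n : nat).
Local Notation deg := (@mdegree v n).
Implicit Types m : monom v n.

Lemma mdegreeM m1 m2 :
  deg (mmul m1 m2) = (deg m1 + deg m2)%N.
Proof. by case: v m1 m2 => m1 m2; [exact: mdegM | exact: fdegM]. Qed.

Lemma mdegree_var i : deg (mvar v i) = 1%N.
Proof. by case: v; [exact: mdegU | exact: fdegU]. Qed.

Lemma mdegree_mone : deg mone = 0%N.
Proof. by case: v; [exact: mdeg1 | exact: fdeg1]. Qed.

Lemma mdegree_eq0 m : deg m = 0%N -> m = mone.
Proof. by case: v m => m; [exact: mdeg_eq0I | exact: fdeg_eq0I]. Qed.

Lemma mvar_lcancel i m1 m2 :
  mmul (mvar v i) m1 = mmul (mvar v i) m2 -> m1 = m2.
Proof.
case: v m1 m2 => /= m1 m2 e.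
  apply/eqP/cmP => j; have := congr1 (fun m : {cmonom 'I_n} => m j) e.
  by rewrite !cmM => /addnI.
apply: val_inj; have := congr1 (fun m : {fmonom 'I_n} => m : seq _) e.
by rewrite !fmM => /(congr1 (drop 1)); rewrite !fmU /= !drop0.
Qed.

Lemma mvar_split m : m <> mone -> exists i m', m = mmul (mvar v i) m'.
Proof.
case: v m => /= m m1.
  have [i mi] : exists i, (0 < m i)%N.
    apply: contrapT => no; apply: m1; apply/eqP/cmP => i; rewrite cm1.
    by case: (posnP (m i)) => // mi; case: no; exists i.
  exists i, (divcm m (ucm i)); apply/eqP/cmP => j; rewrite cmM divcmE cmU.
  by case: eqP => [<-|_]; rewrite ?subn0 // subnKC.
case: m m1 => -[|i s] m1; first by case: m1; apply: val_inj; rewrite [RHS]fm1.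
by exists i, (FMonom s); apply: val_inj; rewrite /= fmM fmU.
Qed.

End Monomials.

Section AdditiveMaps.
Variables (A B : zmodType) (f : A -> B).

(** A bare predicate, to be applied to plain functions such as [taut_inv] and the conjugates of
    [dt]. *)
Definition additive_map := {morph f : x y / x + y}.

Hypothesis fD : additive_map.

Lemma additive_map0 : f 0 = 0.
Proof. by apply: (addrI (f 0)); rewrite -fD !addr0. Qed.

Lemma additive_map_sum (I : finType) (G : I -> A) :
  f (\sum_i G i) = \sum_i f (G i).
Proof. by apply: big_morph => //; exact: additive_map0. Qed.

Lemma additive_mapN x : f (- x) = - f x.
Proof. by apply: (addrI (f x)); rewrite -fD !subrr additive_map0. Qed.

End AdditiveMaps.

Lemma derivation1 (A : nzRingType) (d : A -> A) : is_derivation d -> d 1 = 0.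
Proof.
move=> dM; apply: (addrI (d 1)); rewrite addr0.
by rewrite -{3}[1]mulr1 dM mulr1 mul1r.
Qed.

Section Order.
Variables (v : variables) (n : nat) (R : nzRingType).
Local Notation S := (series (monom v n) R).
Local Notation deg := (@mdegree v n).
Local Notation z i := (zvar R i : S).
Implicit Types u w : S.

Lemma order_geW k l u : (k <= l)%N -> order_ge l u -> order_ge k u.
Proof. by move=> le_kl ou m lt; apply: ou; exact: leq_trans lt le_kl. Qed.

Lemma order_geD k u w : order_ge k u -> order_ge k w -> order_ge k (u + w).
Proof. by move=> ou ow m lt; rewrite serD ou ?ow ?addr0. Qed.

Lemma order_geN k u : order_ge k u -> order_ge k (- u).
Proof. by move=> ou m lt; rewrite serN ou ?oppr0. Qed.

Lemma order_geB k u w : order_ge k u -> order_ge k w -> order_ge k (u - w).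
Proof. by move=> ou ow; apply: order_geD => //; exact: order_geN. Qed.

Lemma order_ge_sum k (I : finType) (G : I -> S) :
  (forall i, order_ge k (G i)) -> order_ge k (\sum_i G i).
Proof. by move=> oG m lt; rewrite ser_sum big1 // => i _; exact: oG. Qed.

Lemma order_geM k l u w :
  order_ge k u -> order_ge l w -> order_ge (k + l) (u * w).
Proof.
move=> ou ow m lt; rewrite serM big_seq big1 // => -[a b].
rewrite mem_factors /= => /eqP e; case: (ltnP (deg a) k) => ha.
  by rewrite ou ?mul0r.
rewrite ow ?mulr0 //; move: lt; rewrite -e mdegreeM => lt.
by rewrite -(ltn_add2l k); apply: leq_ltn_trans lt; rewrite leq_add2r.
Qed.

Lemma order_ge_eq0 u : (forall k, order_ge k u) -> u = 0.
Proof. by move=> ou; apply/funext => m; apply: (ou (deg m).+1). Qed.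

Lemma order_ge_zvar i : order_ge 1 (z i).
Proof.
move=> m; rewrite ltnS leqn0 => /eqP/mdegree_eq0 ->; rewrite /zvar.
case: eqP => // e; have := mdegree_var v i.
by rewrite -e mdegree_mone.
Qed.

Lemma order_ge1_const u : u mone = 0 -> order_ge 1 u.
Proof. by move=> u0 m; rewrite ltnS leqn0 => /eqP/mdegree_eq0 ->. Qed.

(** Each nonconstant monomial is assigned to one variable dividing it on the left, which is then
    factored out. *)
Lemma order_split k u : order_ge k.+1 u ->
  exists2 w : 'I_n -> S, u = \sum_i z i * w i & forall i, order_ge k (w i).
Proof.
(* A commutative monomial can be divisible by several variables; [pick] selects one, so that no
   coefficient is counted twice. *)
move=> ou; pose vhead (m : monom v n) :=
  [pick i | has (fun p => p.1 == mvar v i) (factors m)].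
exists (fun i m => u (mmul (mvar v i) m) *+
                   (vhead (mmul (mvar v i) m) == Some i)); last first.
  by move=> i m lt; rewrite ou ?mul0rn // mdegreeM mdegree_var.
apply/funext => m; rewrite ser_sum.
under eq_bigr => i _.
  rewrite serM (eq_big_seq (fun p =>
    (u m *+ (vhead m == Some i)) *+ (p.1 == mvar v i))).
    over.
  move=> [a b]; rewrite mem_factors /= => /eqP ab; rewrite /zvar.
  by case: eqP => [ea|_]; rewrite ?mul0r // mul1r -ab ea.
case hm: (vhead m) => [i|]; last first.
  rewrite big1 => [|i _]; last by rewrite big1 // => p _; rewrite mul0rn.
  (* Only the monomial 1 has no leading variable, and [u] has no constant term. *)
  apply: ou; case: (eqVneq m mone) => [->|/eqP /mvar_split[i [m' em]]].
    by rewrite mdegree_mone.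
  move: hm; rewrite /vhead; case: pickP => // /(_ i) /hasP no _; case: no.
  by exists (mvar v i, m') => //=; rewrite mem_factors /= em.
rewrite (bigD1 i) //= [X in _ + X]big1 ?addr0 => [|j ne]; last first.
  have -> : (Some i == Some j) = false.
    by apply/eqP => -[e]; rewrite e eqxx in ne.
  by rewrite big1 // => p _; rewrite mul0rn.
move: hm; rewrite /vhead.
case: pickP => // i' /hasP[[a b] hab /eqP /= ea] [ei'].
rewrite eqxx; move: hab; rewrite mem_factors /= ea ei' => /eqP em.
(* By left cancellation exactly one factorization of [m] has left factor [z_i]. *)
rewrite (bigD1_seq (mvar v i, b)) ?factors_uniq ?mem_factors ?em //= eqxx.
rewrite big_seq_cond big1 ?addr0 // => -[a' b'] /=.
rewrite mem_factors /= => /andP[/eqP em' ne]; case: eqP => // ea'.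
by move: em' ne; rewrite ea' -em => /mvar_lcancel ->; rewrite eqxx.
Qed.

Lemma order_split_const u :
  exists2 w : 'I_n -> S, u = u mone *: 1 + \sum_i z i * w i & True.
Proof.
have [|w e _] := @order_split 0 (u - u mone *: 1).
  by apply: order_ge1_const; rewrite serD serN serZ ser1 eqxx mulr1 subrr.
by exists w; rewrite // -e addrC subrK.
Qed.

Lemma derivation_order (d : S -> S) k u :
    additive_map d -> is_derivation d -> (forall i, order_ge 1 (d (z i))) ->
  order_ge k u -> order_ge k (d u).
Proof.
move=> dD dM dz; elim: k u => // k IH u /order_split[w -> ow].
rewrite additive_map_sum //; apply: order_ge_sum => i; rewrite dM.
apply: order_geD; rewrite -add1n; apply: order_geM => //.
  exact: order_ge_zvar.
exact: IH.
Qed.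

(** On [z_i w] the difference [d - e] equals [z_i (d - e)(w)], so by induction its values have order
    at least [k] for every [k]. *)
Lemma derivation_unique (d e : S -> S) :
    additive_map d -> is_derivation d -> (forall c, d (c *: 1) = 0) ->
    additive_map e -> is_derivation e -> (forall c, e (c *: 1) = 0) ->
  (forall i, d (z i) = e (z i)) -> d =1 e.
Proof.
move=> dD dM dZ eD eM eZ de u; apply/eqP; rewrite -subr_eq0; apply/eqP.
apply: order_ge_eq0 => k; elim: k u => // k IH u.
have [w -> _] := order_split_const u.
rewrite dD eD dZ eZ !add0r (additive_map_sum dD) (additive_map_sum eD) -sumrB.
apply: order_ge_sum => i; rewrite dM eM de opprD addrACA subrr add0r -mulrBr.
by rewrite -add1n; apply: order_geM; [exact: order_ge_zvar | exact: IH].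
Qed.

Lemma morphism_order (f : S -> S) k u :
    additive_map f -> {morph f : x y / x * y} ->
    (forall i, order_ge 1 (f (z i))) ->
  order_ge k u -> order_ge k (f u).
Proof.
move=> fD fM fz; elim: k u => // k IH u /order_split[w -> ow].
rewrite additive_map_sum //; apply: order_ge_sum => i; rewrite fM.
by rewrite -add1n; apply: order_geM => //; exact: IH.
Qed.

(** Same induction, with [(f - g)(z_i w) = f(z_i) (f - g)(w)]; the order of [f(z_i)] supplies the
    gain of one degree. *)
Lemma morphism_unique (f g : S -> S) :
    additive_map f -> {morph f : x y / x * y} ->
    additive_map g -> {morph g : x y / x * y} ->
    (forall c, f (c *: 1) = g (c *: 1)) ->
    (forall i, order_ge 1 (f (z i))) ->
  (forall i, f (z i) = g (z i)) -> f =1 g.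
Proof.
move=> fD fM gD gM fgZ fz fg u; apply/eqP; rewrite -subr_eq0; apply/eqP.
apply: order_ge_eq0 => k; elim: k u => // k IH u.
have [w -> _] := order_split_const u.
rewrite fD gD fgZ opprD addrACA subrr add0r.
rewrite (additive_map_sum fD) (additive_map_sum gD) -sumrB.
apply: order_ge_sum => i; rewrite fM gM -fg -mulrBr.
by rewrite -add1n; apply: order_geM; [exact: fz | exact: IH].
Qed.

End Order.

(** * Coefficientwise images under an algebra morphism *)

Section CoefMap.
Variables (K : comAlgType rat) (R R' : algType K) (f : {lrmorphism R -> R'}).
Implicit Types u w : tseries R.
Local Notation F := (tcoef_map f).

Lemma tcoef_mapM u w : F (u * w) = F u * F w.
Proof.
apply/funext => j; rewrite /tcoef_map !tserM raddf_sum /=.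
by apply: eq_bigr => i _; rewrite rmorphM.
Qed.

Lemma tcoef_map1 : F 1 = 1.
Proof. by apply/funext => j; rewrite /tcoef_map !ser1 rmorph_nat. Qed.

Lemma tcoef_mapX u k : F (u ^+ k) = F u ^+ k.
Proof.
by elim: k => [|k IH]; rewrite ?expr0 ?tcoef_map1 // !exprS tcoef_mapM IH.
Qed.

Lemma tcoef_map_tderiv u : F (tderiv u) = tderiv (F u).
Proof. by apply/funext => j; rewrite /tcoef_map /tderiv raddfMn. Qed.

Lemma tcoef_map_tneg u : F (tneg u) = tneg (F u).
Proof.
by apply/funext => j; rewrite /tcoef_map /tneg rmorphM rmorphXn rmorphN1.
Qed.

Lemma tcoef_map_texp u : F (texp u) = texp (F u).
Proof.
apply/funext => j; rewrite /tcoef_map /texp raddf_sum /=.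
by apply: eq_bigr => k _; rewrite linearZ /= -tcoef_mapX.
Qed.

End CoefMap.

Lemma tnegK (R : nzRingType) : involutive (@tneg R).
Proof.
by move=> u; apply/funext => j; rewrite /tneg signrMK.
Qed.

(** * The identification of [K[[t]]<<z>>] with [K<<z>>[[t]]] *)

Section Transpose.
Variables (K : comAlgType rat) (v : variables) (n : nat).
Local Notation Z := (zseries K v n).
Local Notation TZ := (tzseries K v n).
Implicit Types (u w : TZ) (P Q : tseries (endo Z)).

Definition tcoefs u : tseries Z := fun j => tcoef j u.
Definition of_tcoefs (a : tseries Z) : TZ := fun m j => a j m.

Lemma tcoefsK : cancel tcoefs of_tcoefs. Proof. by []. Qed.
Lemma of_tcoefsK : cancel of_tcoefs tcoefs. Proof. by []. Qed.
Lemma tcoefs_inj : injective tcoefs. Proof. exact: can_inj tcoefsK. Qed.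

Lemma tcoefsD u w : tcoefs (u + w) = tcoefs u + tcoefs w.
Proof. by []. Qed.

Lemma tcoefsN u : tcoefs (- u) = - tcoefs u.
Proof. by []. Qed.

Lemma tcoefsM u w : tcoefs (u * w) = tcoefs u * tcoefs w.
Proof.
apply/funext => j; apply/funext => m; rewrite tserM ser_sum.
rewrite /tcoefs /tcoef serM ser_sum; under eq_bigr do rewrite tserM.
by rewrite exchange_big; apply: eq_bigr => i _; rewrite serM.
Qed.

Lemma tcoefs_tact P u : tcoefs (tact P u) = act P (tcoefs u).
Proof.
by apply/funext => j; apply/funext => m; rewrite /act ser_sum.
Qed.

Lemma tcoefs1 : tcoefs 1 = 1.
Proof.
apply/funext => j; apply/funext => m; rewrite /tcoefs /tcoef !ser1.
by case: j => [|j]; rewrite -?[RHS]/((m == mone)%:R); case: (m == mone).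
Qed.

Lemma tcoefs_zvar i : tcoefs (zvar _ i) = tconst (zvar K i).
Proof.
apply/funext => j; apply/funext => m; rewrite /tcoefs /tcoef /zvar.
by case: j => [|j]; rewrite /tconst; case: (m == mvar v i).
Qed.

Lemma tcoefs_scale (c : tseries K) u :
  tcoefs (c *: u) = act (fun j => (c j)%:A) (tcoefs u).
Proof.
apply/funext => j; apply/funext => m; rewrite actE ser_sum /tcoefs /tcoef serZ.
by rewrite tserM; apply: eq_bigr => i _; rewrite endo_scaleE endo1E serZ.
Qed.

Lemma tcoefs_dt u : tcoefs (dt u) = tderiv (tcoefs u).
Proof. by apply/funext => j; apply/funext => m; rewrite /tderiv serMn. Qed.

Lemma tact_mul P Q u : tact (P * Q) u = tact P (tact Q u).
Proof. by apply: tcoefs_inj; rewrite !tcoefs_tact act_mul. Qed.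

Lemma tact1 u : tact 1 u = u.
Proof. by apply: tcoefs_inj; rewrite !tcoefs_tact act1. Qed.

Lemma tactD P u w : tact P (u + w) = tact P u + tact P w.
Proof. by apply: tcoefs_inj; rewrite tcoefsD !tcoefs_tact tcoefsD actDr. Qed.

Lemma tactZ P c u : tact P (c *: u) = c *: tact P u.
Proof.
apply: tcoefs_inj; rewrite tcoefs_tact !tcoefs_scale tcoefs_tact -!act_mul.
(* Scalar endomorphisms commute with the coefficients of [P], so reversing the summation exchanges
   the two factors. *)
congr (act _ _); apply/funext => j; rewrite !tserM (reindex_inj rev_ord_inj).
apply: eq_bigr => i _ /=; rewrite subSS subKn; last by rewrite -ltnS.
by rewrite -scalerAr -scalerAl mulr1 mul1r.
Qed.

(** Identities between series of operators can thus be tested on series constant in [t], which [dt]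
    kills. *)
Lemma tact_inj P Q :
    (forall x : Z,
      tact P (of_tcoefs (tconst x)) = tact Q (of_tcoefs (tconst x))) ->
  P = Q.
Proof.
move=> e; apply: act_inj => x; rewrite -(of_tcoefsK (tconst x)).
by rewrite -!tcoefs_tact e.
Qed.

Lemma is_derivation_act P : is_derivation (tact P) -> is_derivation (act P).
Proof.
move=> dP a b; rewrite -(of_tcoefsK a) -(of_tcoefsK b).
by rewrite -tcoefsM -!tcoefs_tact dP tcoefsD !tcoefsM.
Qed.

Lemma tact_zvar_coef P i j : P j (zvar K i) = tcoef j (tact P (zvar _ i)).
Proof.
by rewrite -[RHS]/(tcoefs (tact P _) j) tcoefs_tact tcoefs_zvar act_tconst.
Qed.

Lemma dtD u w : dt (u + w) = dt u + dt w.
Proof. by apply: tcoefs_inj; rewrite tcoefsD !tcoefs_dt tcoefsD tderivD. Qed.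

Lemma dtN u : dt (- u) = - dt u.
Proof. by apply: tcoefs_inj; rewrite tcoefsN !tcoefs_dt tcoefsN tderivN. Qed.

Lemma dtM : is_derivation (@dt K v n).
Proof.
move=> u w; apply: tcoefs_inj; rewrite tcoefsD !tcoefsM !tcoefs_dt.
by rewrite tcoefsM tderivM.
Qed.

Lemma dt_zvar i : dt (zvar _ i : TZ) = 0.
Proof.
apply: tcoefs_inj; rewrite tcoefs_dt tcoefs_zvar.
by apply/funext => j; rewrite /tderiv mul0rn.
Qed.

Lemma dt_tconst (x : Z) : dt (of_tcoefs (tconst x)) = 0.
Proof.
apply: tcoefs_inj; rewrite tcoefs_dt of_tcoefsK.
by apply/funext => j; rewrite /tderiv mul0rn.
Qed.

Lemma dtZ c u : dt (c *: u) = tderiv c *: u + c *: dt u.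
Proof. by apply/funext => m; rewrite /dt serZ tderivM. Qed.

Lemma dt_order k u : order_ge k u -> order_ge k (dt u).
Proof.
move=> ou m lt; rewrite /dt ou //.
by apply/funext => j; rewrite /tderiv mul0rn.
Qed.

(** Only the operator depends on [t], which converts the derivative of [u(G_t)] into the action of
    [dg/dt]. *)
Lemma dt_tact_tconst P (x : Z) :
  dt (tact P (of_tcoefs (tconst x))) = tact (tderiv P) (of_tcoefs (tconst x)).
Proof.
apply: tcoefs_inj; rewrite tcoefs_dt !tcoefs_tact of_tcoefsK.
by apply/funext => j; rewrite /tderiv !act_tconst endo_mulrnE.
Qed.

Lemma tcoef_order k j u : order_ge k u -> order_ge k (tcoef j u).
Proof. by move=> ou m lt; rewrite /tcoef ou. Qed.

End Transpose.

Section DopVal.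
Variables (K : comAlgType rat) (v : variables) (n alpha : nat).
Local Notation E := (endo (zseries K v n)).

Definition dop_val (P : Dop K v n alpha) : E := genalg_val P.

Fact dop_val_monoid : monoid_morphism dop_val. Proof. by []. Qed.
Fact dop_val_linear : linear dop_val. Proof. by []. Qed.
HB.instance Definition _ := GRing.isLinear.Build K (Dop K v n alpha) E *:%R
  dop_val dop_val_linear.
HB.instance Definition _ := GRing.isMonoidMorphism.Build (Dop K v n alpha) E
  dop_val dop_val_monoid.

Lemma dop_val_inj : injective dop_val. Proof. exact: val_inj. Qed.

Lemma topsE (P : tseries (Dop K v n alpha)) : tops P = tcoef_map dop_val P.
Proof. by []. Qed.

Lemma tops_inj : injective (@tops K v n alpha).
Proof.
move=> P Q e; apply/funext => j; apply: dop_val_inj.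
by have := congr1 (fun X : nat -> E => X j) e.
Qed.

End DopVal.

(** * The relations between the components of Omega *)

Section OmegaRelations.
Variables (K : comAlgType rat) (v : variables) (n alpha : nat).
Hypothesis alpha_gt0 : (0 < alpha)%N.
Variable F : tautomorphism K v n alpha.
Local Notation Z := (zseries K v n).
Local Notation TZ := (tzseries K v n).
Local Notation G := (taut_inv F).
Local Notation z i := (zvar _ i : TZ).
Implicit Types u w : TZ.

Lemma taut_invD : additive_map G.
Proof.
by move=> u w; apply: (can_inj (tautK F)); rewrite raddfD /= !taut_invK.
Qed.

Lemma taut_invM : {morph G : u w / u * w}.
Proof.
by move=> u w; apply: (can_inj (tautK F)); rewrite rmorphM /= !taut_invK.
Qed.

Lemma taut_invZ c u : G (c *: u) = c *: G u.
Proof. by apply: (can_inj (tautK F)); rewrite linearZ /= !taut_invK. Qed.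

Lemma taut_inv1 : G 1 = 1.
Proof. by apply: (can_inj (tautK F)); rewrite rmorph1 taut_invK. Qed.

Lemma taut_zvar i : F (z i) = z i - Ht F i.
Proof. by rewrite /Ht opprB addrC subrK. Qed.

Lemma taut_zvar_order i : order_ge 1 (F (z i)).
Proof.
rewrite taut_zvar; apply: order_geB; first exact: order_ge_zvar.
by apply: (order_geW alpha_gt0); exact: taut_order.
Qed.

Lemma taut_keeps_order k u : order_ge k u -> order_ge k (F u).
Proof.
apply: morphism_order => [x y|x y|]; rewrite ?raddfD ?rmorphM //.
exact: taut_zvar_order.
Qed.

(* A constant term of [G z_i] would survive in [F (G z_i) = z_i]. *)
Lemma taut_inv_zvar_order i : order_ge 1 (G (z i)).
Proof.
set c := G (z i) mone; have oGc : order_ge 1 (G (z i) - c *: 1).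
  by apply: order_ge1_const; rewrite serD serN serZ ser1 eqxx mulr1 subrr.
have := taut_keeps_order oGc; rewrite raddfB /= linearZ /= rmorph1 taut_invK.
move/(_ mone); rewrite mdegree_mone serD serN serZ ser1 eqxx mulr1.
have -> : z i mone = 0 by apply: (@order_ge_zvar v n); rewrite mdegree_mone.
rewrite add0r => /(_ isT) /eqP; rewrite oppr_eq0 => /eqP c0.
by move: oGc; rewrite c0 scale0r subr0.
Qed.

Lemma taut_inv_keeps_order k u : order_ge k u -> order_ge k (G u).
Proof.
exact: morphism_order taut_invD taut_invM taut_inv_zvar_order.
Qed.

(** From [G(F(z)) = z], that is [M_t = H_t(G_t)]; this carries the order bound from [Ht] to [Mt]. *)
Lemma MtE i : Mt F i = G (Ht F i).
Proof.
rewrite /Mt -{2}[z i](tautK F) taut_zvar.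
by rewrite taut_invD (additive_mapN taut_invD) opprB addrC subrK.
Qed.

Lemma dtF_conj_order i : order_ge alpha (F (dt (Mt F i))).
Proof.
apply/taut_keeps_order/dt_order; rewrite MtE; apply: taut_inv_keeps_order.
exact: taut_order.
Qed.

Lemma vector_field_unique (a : 'I_n -> TZ) P (d : TZ -> TZ) :
    is_vector_field a P ->
    additive_map d -> is_derivation d -> (forall c, d (c *: 1) = 0) ->
  (forall i, d (z i) = a i) -> tact P =1 d.
Proof.
case=> dP Pz dD dM d1 dz; apply: derivation_unique => //.
- exact: tactD.
- by move=> c; rewrite tactZ (derivation1 dP) scaler0.
- by move=> i; rewrite Pz dz.
Qed.

(** The conjugate [F dt G] is a derivation acting on [K[[t]]] as [dt] does, so subtracting [dt]
    makes it vanish on scalars; its value on [z_i] is as required because [dt z_i = 0]. *)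
Lemma vector_field_h P : is_vector_field (fun i => F (dt (Mt F i))) P ->
  forall u, tact P u = F (dt (G u)) - dt u.
Proof.
move=> vP; apply: (vector_field_unique vP).
- by move=> u w; rewrite taut_invD !dtD raddfD opprD addrACA.
- move=> u w; rewrite taut_invM !dtM raddfD /= !rmorphM /= !taut_invK.
  by rewrite mulrBl mulrBr opprD addrACA.
- move=> c; rewrite taut_invZ taut_inv1 dtZ (derivation1 (@dtM _ _ _)).
  by rewrite scaler0 addr0 linearZ /= rmorph1 subrr.
- by move=> i; rewrite /Mt dtD dtN dt_zvar !subr0.
Qed.

Lemma vector_field_m P : is_vector_field (fun i => G (dt (Ht F i))) P ->
  forall u, tact P u = dt u - G (dt (F u)).
Proof.
move=> vP; apply: (vector_field_unique vP).
- by move=> u w; rewrite raddfD !dtD taut_invD opprD addrACA.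
- move=> u w; rewrite rmorphM !dtM taut_invD !taut_invM !tautK.
  by rewrite mulrBl mulrBr opprD addrACA.
- move=> c; rewrite linearZ /= rmorph1 dtZ (derivation1 (@dtM _ _ _)).
  by rewrite scaler0 addr0 taut_invZ taut_inv1 subrr.
- move=> i; rewrite dt_zvar add0r /Ht dtD dt_zvar add0r dtN.
  by rewrite (additive_mapN taut_invD).
Qed.

Variable X : tuple5 (Dop K v n alpha).
Hypothesis OmegaX : is_Omega F X.

Lemma Omega_gf : tup_g X * tneg (tup_f X) = 1.
Proof.
apply: tops_inj; rewrite !topsE tcoef_mapM tcoef_map1.
apply: tact_inj => x; rewrite tact_mul tact1 -!topsE.
by rewrite (Omega_f OmegaX) (Omega_g OmegaX) tautK.
Qed.

Lemma Omega_fg : tneg (tup_f X) * tup_g X = 1.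
Proof.
apply: tops_inj; rewrite !topsE tcoef_mapM tcoef_map1.
apply: tact_inj => x; rewrite tact_mul tact1 -!topsE.
by rewrite (Omega_f OmegaX) (Omega_g OmegaX) taut_invK.
Qed.

(** For [x] constant in [t], [h] acts as [F dt G], so [g h] sends [x] to [G F dt G x = dt (G x)]. *)
Lemma Omega_tderiv_h : tderiv (tup_g X) = tup_g X * tup_h X.
Proof.
apply: tops_inj; rewrite !topsE tcoef_mapM tcoef_map_tderiv -!topsE.
apply: tact_inj => x; rewrite tact_mul -dt_tact_tconst !(Omega_g OmegaX).
by rewrite (vector_field_h (Omega_h OmegaX)) dt_tconst subr0 tautK.
Qed.

Lemma Omega_tderiv_m : tderiv (tup_g X) = tup_m X * tup_g X.
Proof.
apply: tops_inj; rewrite !topsE tcoef_mapM tcoef_map_tderiv -!topsE.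
apply: tact_inj => x; rewrite tact_mul -dt_tact_tconst !(Omega_g OmegaX).
rewrite (vector_field_m (Omega_m OmegaX)) taut_invK dt_tconst.
by rewrite (additive_map0 taut_invD) subr0.
Qed.

Lemma Omega_texp : tup_d X 0%N = 0 /\ texp (tup_d X) = tup_g X.
Proof.
have [a [D [[a0 oa [dD Da] expD] dX]]] := Omega_d OmegaX.
have dD' := is_derivation_act dD.
(* The constant term of [D] is a derivation killing every [z_i], since [a] vanishes at [t = 0]. *)
have D0 : D 0%N = 0.
  apply: endoP => x; rewrite endo0E.
  apply: (@derivation_unique v n K (D 0%N) (fun=> 0)) => [y w||c|y w|y w|c|i].
  - exact: raddfD.
  - exact: act_derivation_coef.
  - by rewrite linearZ /= (derivation1 (act_derivation_coef dD' 0%N)) scaler0.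
  - by rewrite addr0.
  - by rewrite mulr0 mul0r addr0.
  - by [].
  - by rewrite tact_zvar_coef Da a0.
have d0 : tup_d X 0%N = 0.
  apply: dop_val_inj; rewrite -[LHS]/(tops (tup_d X) 0%N) dX serN D0 oppr0.
  by rewrite raddf0.
split=> //.
(* A derivation kills 1, so only the term of index 0 of the exponential survives. *)
have texpD1 : tact (texp D) 1 = 1.
  apply: tcoefs_inj; rewrite tcoefs_tact tcoefs1; apply/funext => j.
  have tconst1 : (1 : tseries Z) = tconst 1 by apply/funext => -[|k].
  rewrite tconst1 act_tconst /texp endo_sumE big_ord_recl expr0 big1 => [|k _].
    rewrite endo_scaleE fact0 invr1 !scale1r addr0 ser1.
    by case: j.
  rewrite endo_scaleE; apply/eqP; rewrite -(act_tconst (D ^+ _)) /= exprSr.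
  by rewrite act_mul -tconst1 (derivation1 dD') act0r ser0 scaler0.
have texpDF : tact (texp D) =1 F.
  apply: morphism_unique => [u w|u w|u w|u w|c|i|i].
  - exact: tactD.
  - apply: tcoefs_inj; rewrite tcoefs_tact !tcoefsM !tcoefs_tact.
    exact: texp_derivationM.
  - exact: raddfD.
  - exact: rmorphM.
  - by rewrite tactZ texpD1 linearZ /= rmorph1.
  - by rewrite expD; exact: taut_zvar_order.
  - exact: expD.
have fD : tops (tneg (tup_f X)) = texp D.
  by apply: tact_inj => x; rewrite texpDF (Omega_f OmegaX).
(* With [d = -D] and [f(-t) = e^D], one has [e^(-D) = g f(-t) e^(-D) = g]. *)
apply: tops_inj; rewrite topsE tcoef_map_texp -topsE dX.
rewrite -[LHS]mul1r -(tcoef_map1 (@dop_val K v n alpha)) -Omega_gf tcoef_mapM.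
by rewrite -!topsE fD -mulrA texpN // mulr1.
Qed.

Lemma Omega_h_Der j : dop_val (tup_h X j) \in Der K v n alpha.
Proof.
have [dP Pz] := Omega_h OmegaX; apply/asboolP; split.
  exact: act_derivation_coef (is_derivation_act dP) j.
move=> i; rewrite -[dop_val _]/(tops (tup_h X) j) tact_zvar_coef Pz.
by apply/tcoef_order/dtF_conj_order.
Qed.

End OmegaRelations.

(** * The derivations of order at least [alpha] form a Lie algebra *)

Section DerLie.
Variables (K : comAlgType rat) (v : variables) (n alpha : nat).
Hypothesis alpha_gt0 : (0 < alpha)%N.
Local Notation E := (endo (zseries K v n)).
Local Notation L := (Der K v n alpha).

Lemma Der0 : (0 : E) \in L.
Proof.
by apply/asboolP; split=> [x y|i m _] //; rewrite !endo0E mul0r mulr0 addr0.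
Qed.

Lemma Der_linear k (d e : E) : d \in L -> e \in L -> k *: d + e \in L.
Proof.
move=> /asboolP[dM dz] /asboolP[eM ez]; apply/asboolP; split.
  move=> x y; rewrite !endo_addE !endo_scaleE dM eM scalerDr mulrDl mulrDr.
  by rewrite -scalerAl -scalerAr addrACA.
move=> i; rewrite endo_addE endo_scaleE; apply: order_geD => // m lt.
by rewrite serZ dz ?mulr0.
Qed.

(** The mixed products cancel in the Leibniz rule. For [alpha >= 1] these derivations do not lower
    the order, so [d (e z_i)] and [e (d z_i)] keep order at least [alpha]. *)
Lemma Der_bracket (d e : E) : d \in L -> e \in L -> d * e - e * d \in L.
Proof.
move=> /asboolP[dM dz] /asboolP[eM ez]; apply/asboolP; split.
  move=> x y; rewrite !endo_addE.
  rewrite -[(- (e * d)) (x * y)]/(- e (d (x * y))) -[(- (e * d)) x]/(- e (d x)).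
  rewrite -[(- (e * d)) y]/(- e (d y)) !endo_mulE dM eM !raddfD /= !dM !eM.
  rewrite mulrBl mulrBr [d x * e y + _]addrC addrACA
    [_ * _ + x * e (d y)]addrC.
  rewrite !opprD (addrACA (d (e x) * y)) (addrACA (x * d (e y))).
  rewrite (addrACA (d (e x) * y - _)).
  by rewrite -[e x * d y - _]opprB addNr addr0.
move=> i; rewrite endo_addE; apply: order_geB.
  apply: derivation_order dM _ (ez i) => [x y|j]; first exact: raddfD.
  exact: order_geW (dz j).
apply: derivation_order eM _ (dz i) => [x y|j]; first exact: raddfD.
exact: order_geW (ez j).
Qed.

End DerLie.

(** * Noncommutative symmetric functions *)

Section UniversalTuple.
Variables (K : comAlgType rat) (Pi : tuple5 (NSym K)).
Hypothesis PiP : is_universal_tuple Pi.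

Lemma univ_g0 : tup_g Pi 0%N = 1.
Proof.
have := congr1 (fun u : tseries _ => u 0%N) (univ_gf PiP).
by rewrite tserM0 /tneg (univ_f0 PiP) !mulr1.
Qed.

Lemma falg_ind (X : choiceType) (Q : falg K X -> Prop) :
    Q 1 -> (forall k x y, Q x -> Q y -> Q (k *: x + y)) ->
    (forall x y, Q x -> Q y -> Q (x * y)) -> (forall x, Q (fgen K x)) ->
  forall x, Q x.
Proof.
move=> Q1 QD QM Qg x; have Q0 : Q 0.
  by rewrite -[0](addNr 1) -scaleN1r; exact: QD.
rewrite [x](monalgE (x : {malg K[{fmonom X}]})).
elim: (msupp _ : seq _) => [|m s IH]; first by rewrite big_nil.
rewrite big_cons; have -> : << x@_m *g m >> = x@_m *: << m >> :> falg K X.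
  by apply/malgP => p; rewrite mcoeffZ !mcoeffU mulrnAr mulr1.
apply: QD => //; case: m => m; elim: m => [|i m IHm].
  by rewrite -fmoneE.
have -> : << FMonom (i :: m) >> = fgen K i * << FMonom m >> :> falg K X.
  rewrite [RHS](_ : _ = << 1 * 1 *g mmul (fmu i) (FMonom m) >>); last first.
    by rewrite -fgmulUU malgM_def.
  by rewrite mulr1; congr << _ >>; apply: val_inj; rewrite /= fmM fmU.
exact: QM.
Qed.

(* Newton's identities express the S_m, hence the Lambda_m, through the
   Psi_m, since K contains the rationals. *)
Lemma NSym_Psi_ind (Q : NSym K -> Prop) :
    Q 1 -> (forall k x y, Q x -> Q y -> Q (k *: x + y)) ->
    (forall x y, Q x -> Q y -> Q (x * y)) -> (forall j, Q (tup_h Pi j)) ->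
  forall x, Q x.
Proof.
move=> Q1 QD QM Qh.
have Q0 : Q 0 by rewrite -[0](addNr 1) -scaleN1r; exact: QD.
have QZ k x : Q x -> Q (k *: x) by move=> Qx; rewrite -[_ *: _]addr0; exact: QD.
have Qsum (I : finType) (G : I -> NSym K) :
    (forall i, Q (G i)) -> Q (\sum_i G i).
  move=> QG; elim/big_rec: _ => // i x _ Qx.
  by rewrite -[G i]scale1r; exact: QD.
have QS j : Q (tup_g Pi j).
  elim/ltn_ind: j => -[|j] IH; first by rewrite univ_g0.
  rewrite -[tup_g Pi _](divnK j) scalerMnr.
  rewrite -[X in Q (_ *: X)]/(tderiv (tup_g Pi) j).
  rewrite (univ_h PiP) tserM; apply/QZ/Qsum => i.
  by apply: QM => //; apply: IH; rewrite ltn_ord.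
have QL j : Q (tneg (tup_f Pi) j).
  elim/ltn_ind: j => -[|j] IH; first by rewrite /tneg (univ_f0 PiP) mulr1.
  have := congr1 (fun u : tseries _ => u j.+1) (univ_fg PiP).
  rewrite tserM big_ord_recr /= subnn univ_g0 mulr1 ser1 => /eqP.
  rewrite addrC addr_eq0 => /eqP ->; rewrite -scaleN1r; apply/QZ/Qsum => i.
  by apply: QM => //; exact: IH.
apply: falg_ind => // i; rewrite -(univ_fS PiP) -[tup_f Pi]tnegK /tneg.
rewrite -/(tneg _ _) -signr_odd; case: odd; rewrite ?mul1r // mulN1r.
by rewrite -scaleN1r; apply: QZ.
Qed.

Variable R : algType K.

(** Freeness on the [Psi_m]: [h] determines the image [s] of [sigma(t)] by [s' = s h], and the
    inverse of [s] prescribes the images of the free generators. *)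
Lemma NSym_lift (h : tseries R) :
  exists phi : {lrmorphism NSym K -> R}, tcoef_map phi (tup_h Pi) = h.
Proof.
have [s s0 sh] := oder_exists h.
have [r sr] := tser_rinv_exists s0.
have r0 : r 0%N = 1.
  have := congr1 (fun u : tseries _ => u 0%N) sr.
  by rewrite tserM0 s0 mul1r.
(* The series [r] is to be the image of [lambda(-t)], whence the signs; the generator of index [m]
   is [Lambda_(m+1)]. *)
pose phi : {lrmorphism NSym K -> R} :=
  falg_lift (fun m => tneg r m.+1).
exists phi.
have phif : tcoef_map phi (tneg (tup_f Pi)) = r.
  rewrite tcoef_map_tneg -[RHS]tnegK; congr tneg; apply/funext => -[|j].
    by rewrite /tcoef_map (univ_f0 PiP) rmorph1 /tneg r0 mulr1.
  by rewrite /tcoef_map (univ_fS PiP) /phi /= falg_lift_gen.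
(* As [r] is a right inverse of [s] and a left inverse of the image of [sigma(t)], these two series
   coincide. *)
have rg : r * tcoef_map phi (tup_g Pi) = 1.
  by rewrite -phif -tcoef_mapM (univ_fg PiP) tcoef_map1.
have gs : tcoef_map phi (tup_g Pi) = s.
  by rewrite -[LHS]mul1r -sr -mulrA rg mulr1.
have := congr1 (tcoef_map phi) (univ_h PiP).
rewrite tcoef_map_tderiv tcoef_mapM gs sh => /(congr1 ( *%R r)).
by rewrite !mulrA -gs rg !mul1r.
Qed.

(** The [Psi_m] fix the other components: [sigma] by its linear differential equation, [lambda(-t)]
    as its inverse, [Phi] as its logarithm, and [xi] by cancelling [sigma] on the right. *)
Lemma universal_tuple_map (phi : {lrmorphism NSym K -> R}) (X : tuple5 R) :
    tneg (tup_f X) * tup_g X = 1 -> tup_g X * tneg (tup_f X) = 1 ->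
    tup_g X 0%N = 1 -> tup_d X 0%N = 0 -> texp (tup_d X) = tup_g X ->
    tderiv (tup_g X) = tup_g X * tup_h X ->
    tderiv (tup_g X) = tup_m X * tup_g X ->
  tcoef_map phi (tup_h Pi) = tup_h X -> tuple5_map phi Pi = X.
Proof.
move=> fg gf g0 d0 expd gh mg phih.
have phig : tcoef_map phi (tup_g Pi) = tup_g X.
  apply: (@oder_unique K R (tup_h X)) => //.
    by rewrite /tcoef_map univ_g0 rmorph1 g0.
  by rewrite -tcoef_map_tderiv (univ_h PiP) tcoef_mapM phih.
have phif : tcoef_map phi (tup_f Pi) = tup_f X.
  apply: (can_inj (@tnegK R)); rewrite -tcoef_map_tneg.
  rewrite -[LHS]mulr1 -gf -phig mulrA -tcoef_mapM (univ_fg PiP).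
  by rewrite tcoef_map1 mul1r.
have phid : tcoef_map phi (tup_d Pi) = tup_d X.
  apply: (@texp_inj K R) => //.
    by rewrite /tcoef_map (univ_d0 PiP) raddf0.
  by rewrite -tcoef_map_texp (univ_d PiP) phig expd.
have phim : tcoef_map phi (tup_m Pi) = tup_m X.
  have := congr1 (tcoef_map phi) (univ_m PiP).
  rewrite tcoef_map_tderiv tcoef_mapM phig mg.
  move/(congr1 ( *%R^~ (tneg (tup_f X)))).
  by rewrite -!mulrA gf !mulr1.
by rewrite /tuple5_map phig phif phid phim phih; case: (X).
Qed.

End UniversalTuple.

(** * Hopf algebra morphisms *)

Section LinearMaps.
Variables (K : comNzRingType) (U V W : lmodType K).

Lemma linear_comp (f : V -> W) (g : U -> V) :
  linear f -> linear g -> linear (f \o g).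
Proof. by move=> lf lg k x y /=; rewrite lg lf. Qed.

Lemma linear_comb (f g : U -> V) c : linear f -> linear g ->
  linear (fun x => c *: f x + g x).
Proof. by move=> lf lg k x y /=; rewrite lf lg; exact: scaleACA. Qed.

Lemma linear_fun0 (f : U -> V) : linear f -> f 0 = 0.
Proof.
move=> lf; have := lf (-1) 0 0.
by rewrite scaler0 addr0 scaleN1r addNr.
Qed.

End LinearMaps.

(** * Linear maps on tensor products and convolution *)

Section TensorMaps.
Variables (K : comNzRingType).

Lemma tens_ext (A B M : lmodType K) (f g : tensor A B -> M) :
    linear f -> linear g -> (forall a b, f (tens a b) = g (tens a b)) ->
  f =1 g.
Proof.
move=> lf lg fg; elim/tens_ind => [|k a b x IH]; first by rewrite !linear_fun0.
by rewrite lf lg fg IH.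
Qed.

Lemma bilinear_mul (A B : lmodType K) (M : algType K) (f : A -> M)
    (g : B -> M) :
  linear f -> linear g -> bilinear2 (fun a b => f a * g b).
Proof.
move=> lf lg; split=> [a|b] k x y; first by rewrite lg mulrDr scalerAr.
by rewrite lf mulrDl scalerAl.
Qed.

Lemma bilinear_tens (A B A' B' : lmodType K) (f : A -> A') (g : B -> B') :
  linear f -> linear g -> bilinear2 (fun a b => tens (f a) (g b)).
Proof.
move=> lf lg; split=> [a|b] k x y; first by rewrite lg (tens_bilinear _ _).1.
by rewrite lf (tens_bilinear _ _).2.
Qed.

Lemma bilinear_comp (A B M N : lmodType K) (beta : A -> B -> M) (f : M -> N) :
  bilinear2 beta -> linear f -> bilinear2 (fun a b => f (beta a b)).
Proof. by move=> [bl br] lf; split=> c k x y; rewrite ?bl ?br lf. Qed.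

Lemma tlift_comp (A B M N : lmodType K) (beta : A -> B -> M) (f : M -> N) x :
    bilinear2 beta -> linear f ->
  f (tlift beta x) = tlift (fun a b => f (beta a b)) x.
Proof.
move=> bb lf; have bfb := bilinear_comp bb lf.
apply: (tens_ext (f := fun x => f (tlift beta x))) => [||a b].
- exact: (linear_comp lf (tlift_linear bb)).
- exact: tlift_linear.
- by rewrite !tliftE.
Qed.

Lemma tlift_tmap (A B A' B' M : lmodType K) (beta : A' -> B' -> M)
    (f : A -> A') (g : B -> B') x :
    bilinear2 beta -> linear f -> linear g ->
  tlift beta (tmap f g x) = tlift (fun a b => beta (f a) (g b)) x.
Proof.
move=> bb lf lg; rewrite /tmap (tlift_comp _ (bilinear_tens lf lg)) //.
  by congr tlift; apply/funext => a; apply/funext => b; rewrite tliftE.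
exact: tlift_linear.
Qed.

Lemma tlift_param_linear (A B C M : lmodType K) (beta : C -> A -> B -> M) :
    (forall c, bilinear2 (beta c)) -> (forall a b, linear (beta ^~ a ^~ b)) ->
  forall x, linear (fun c => tlift (beta c) x).
Proof.
move=> bb lb x k c d; move: x; apply: tens_ext => [||a b].
- exact: tlift_linear.
- by apply: linear_comb; exact: tlift_linear.
by rewrite !tliftE // lb.
Qed.

Lemma eq_tlift (A B M : lmodType K) (beta gamma : A -> B -> M) :
  beta =2 gamma -> tlift beta =1 tlift gamma.
Proof.
by move=> e x; congr tlift; apply/funext => a; apply/funext => b.
Qed.

Lemma tmap_linear (A B A' B' : lmodType K) (f : A -> A') (g : B -> B') :
  linear f -> linear g -> linear (tmap f g).
Proof. by move=> lf lg; apply/tlift_linear/bilinear_tens. Qed.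

Lemma tmapE (A B A' B' : lmodType K) (f : A -> A') (g : B -> B') a b :
  linear f -> linear g -> tmap f g (tens a b) = tens (f a) (g b).
Proof. by move=> lf lg; rewrite /tmap tliftE //; exact: bilinear_tens. Qed.

Lemma tmul_linearl (A B : algType K) (y : tensor A B) :
  linear (@tmul K A B ^~ y).
Proof.
move=> k x x'; rewrite /tmul /=.
exact (@tlift_linear K A B (tensor A B) _ (@tmul_bilinear K A B y) k x x').
Qed.

Lemma tmul_tensl (A B : algType K) (a : A) (b : B) y :
  tmul (tens a b) y = tlift (fun a' b' => tens (a * a') (b * b')) y.
Proof. exact (@tliftE K A B (tensor A B) _ (@tmul_bilinear K A B y) a b). Qed.

Lemma tmul_linearr (A B : algType K) (x : tensor A B) : linear (tmul x).
Proof.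
move=> k y z; move: x; apply: tens_ext.
- exact: tmul_linearl.
- by apply: linear_comb; exact: tmul_linearl.
move=> a b; rewrite !tmul_tensl.
by apply: tlift_linear; apply: bilinear_tens => c u w; rewrite mulrDr scalerAr.
Qed.

Lemma tmap_tmul (A B A' B' : algType K) (f : {lrmorphism A -> A'})
    (g : {lrmorphism B -> B'}) x y :
  tmap f g (tmul x y) = tmul (tmap f g x) (tmap f g y).
Proof.
have lf : linear f by exact: linearP.
have lg : linear g by exact: linearP.
have lfg := tmap_linear lf lg.
move: x; apply: tens_ext => [||a b].
- exact: (linear_comp lfg (tmul_linearl y)).
- exact: (linear_comp (tmul_linearl _) lfg).
move: y; apply: tens_ext => [||a' b'].
- exact: (linear_comp lfg (tmul_linearr _)).
- exact: (linear_comp (tmul_linearr _) lfg).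
by rewrite tmulE !tmapE // tmulE !rmorphM.
Qed.

(** Associativity of the convolution product, on an arbitrary tensor [t] in place of an iterated
    coproduct. *)
Lemma convolution_assoc (A : lmodType K) (B : algType K) (u v w : A -> B)
    (t : tensor (tensor A A) A) : linear u -> linear v -> linear w ->
  tlift (fun p c => tlift (fun a b => u a * v b) p * w c) t =
  tlift (fun a q => u a * tlift (fun b c => v b * w c) q) (tassoc t).
Proof.
move=> lu lv lw; have luv := tlift_linear (bilinear_mul lu lv).
have lvw := tlift_linear (bilinear_mul lv lw).
have lL := tlift_linear (bilinear_mul luv lw).
have lR := tlift_linear (bilinear_mul lu lvw).
have bin (c : A) : bilinear2 (fun a b : A => tens a (tens b c)).
  split=> [a|b] k x y; last exact: (tens_bilinear _ _).2.
  by rewrite (tens_bilinear _ _).2 (tens_bilinear _ _).1.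
have bout : bilinear2
    (fun (x : tensor A A) (c : A) => tlift (fun a b => tens a (tens b c)) x).
  split=> [x|c]; last exact: tlift_linear.
  apply: tlift_param_linear => // a b.
  exact: (linear_comp ((tens_bilinear A (tensor A A)).1 a)
    ((tens_bilinear A A).1 b)).
have lassoc : linear (@tassoc K A A A) by exact: tlift_linear.
move: t; apply: tens_ext => // [|p c]; first exact: (linear_comp lR lassoc).
rewrite (tliftE (bilinear_mul luv lw)) /tassoc (tliftE bout).
move: p; apply: tens_ext => [k x y||a b].
- by rewrite luv mulrDl scalerAl.
- exact: (linear_comp lR (tlift_linear (bin c))).
rewrite (tliftE (bilinear_mul lu lv)) (tliftE (bin c)).
by rewrite (tliftE (bilinear_mul lu lvw)) (tliftE (bilinear_mul lv lw)) mulrA.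
Qed.

End TensorMaps.

Section HopfMorphism.
Variables (K : comNzRingType) (A B : algType K).
Variables (hA : hopf_structure A) (hB : hopf_structure B).
Variable f : {lrmorphism A -> B}.
Hypothesis f_comul : forall x, comul hB (f x) = tmap f f (comul hA x).
Hypothesis f_counit : forall x, counit hB (f x) = counit hA x.

(* [antipode hB \o f] and [f \o antipode hA] are a left and a right inverse of
   [f] for convolution. *)
Lemma hopf_hom_of_bialgebra_hom : is_hopf_hom hA hB f.
Proof.
split=> // x.
have lf : linear f by exact: linearP.
have lSA : linear (antipode hA) by exact: linearP.
have lSB : linear (antipode hB) by exact: linearP.
have lu := linear_comp lSB lf; have lw := linear_comp lf lSA.
have lid (C : lmodType K) : linear (fun c : C => c) by [].
have luf := bilinear_mul lu lf; have lfw := bilinear_mul lf lw.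
have uf y : tlift (fun a b => antipode hB (f a) * f b) (comul hA y) =
    (counit hA y : K) *: 1.
  rewrite -f_counit -antipodel f_comul tlift_tmap //.
  exact: (bilinear_mul lSB (lid _)).
have fw y : tlift (fun a b => f a * f (antipode hA b)) (comul hA y) =
    (counit hA y : K) *: 1.
  have <- : f (tlift (fun a b => a * antipode hA b) (comul hA y)) =
      (counit hA y : K) *: 1 by rewrite antipoder linearZ /= rmorph1.
  rewrite (tlift_comp (f := f)) //.
    by apply: eq_tlift => a b; rewrite rmorphM.
  exact: (bilinear_mul (lid _) lSA).
have lcA : linear (fun a => (counit hA a : K) *: (1 : B)).
  by move=> k a b; rewrite linearP scalerDl scalerA.
(* The two bracketings of the triple convolution of [antipode hB \o f], [f] and [f \o antipode hA]
   are compared at [x]. *)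
have := convolution_assoc (tmap (comul hA) idfun (comul hA x)) lu lf lw.
have lcom : linear (comul hA) by exact: linearP.
have bL := bilinear_mul (tlift_linear luf) lw.
have bR := bilinear_mul lu (tlift_linear lfw).
rewrite comulA (tlift_tmap _ bL lcom (lid A)) (tlift_tmap _ bR (lid A) lcom).
(* The inner convolutions collapse to counits, which the counit axioms then absorb. *)
under eq_tlift do rewrite /= uf -scalerAl mul1r.
under [RHS]eq_tlift do rewrite /= fw -scalerAr mulr1.
have blf : bilinear2 (fun a b => (counit hA a : K) *: (b : A)).
  split=> [a|b] k y z; last by rewrite linearP scalerDl scalerA.
  by rewrite scalerDr !scalerA mulrC.
have brf : bilinear2 (fun a b => (counit hA b : K) *: (a : A)).
  split=> [a|b] k y z; first by rewrite linearP scalerDl scalerA.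
  by rewrite scalerDr !scalerA mulrC.
have -> : tlift (fun a b => (counit hA a : K) *: f (antipode hA b)) (comul hA x)
    = f (antipode hA x).
  transitivity ((f \o antipode hA)
    (tlift (fun a b => (counit hA a : K) *: b) (comul hA x)));
    last by rewrite counitl.
  rewrite (tlift_comp _ blf lw).
  by apply: eq_tlift => a b /=; rewrite !linearZ.
have -> : tlift (fun a b => (counit hA b : K) *: antipode hB (f a)) (comul hA x)
    = antipode hB (f x).
  transitivity ((antipode hB \o f)
    (tlift (fun a b => (counit hA b : K) *: a) (comul hA x)));
    last by rewrite counitr.
  rewrite (tlift_comp _ brf lu).
  by apply: eq_tlift => a b /=; rewrite !linearZ.
by [].
Qed.

End HopfMorphism.

(** * Primitive elements of an enveloping algebra *)

Local Notation span := Defs.span.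

Section SpanDivision.
Variables (K : comAlgType rat) (V : lmodType K) (P : V -> Prop).

Lemma span_mulrSn j v : v *+ j.+1 \in span P -> v \in span P.
Proof. by move=> h; rewrite -[v](divnK j) scalerMnr; exact: rpredZ. Qed.

Lemma span_subset (Q : V -> Prop) : (forall v, P v -> v \in span Q) ->
  {subset span P <= span Q}.
Proof.
move=> PQ v /spanP; elim=> [|k x w Px _ IH]; first exact: rpred0.
by apply: rpredD => //; apply/rpredZ/PQ.
Qed.

Lemma mulrn_pow2_inj i j v : (i < j)%N ->
  v *+ 2 ^ i - v *+ 2 ^ j \in span P -> v \in span P.
Proof.
move=> lt_ij; have lt2 : (2 ^ i < 2 ^ j)%N by rewrite ltn_exp2l.
rewrite -opprB rpredN -mulrnBr; last exact: ltnW.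
case: (2 ^ j - 2 ^ i)%N (subn_gt0 (2 ^ i) (2 ^ j)) => [|m _].
  by rewrite lt2.
exact: span_mulrSn.
Qed.

(* Replacing [f(k)] by [f(2k) - 2^d f(k)] kills the leading coefficient. *)
Lemma span_coef d (c : nat -> V) :
    (forall k, \sum_(j < d) c j *+ k ^ j \in span P) ->
  forall j, (j < d)%N -> c j \in span P.
Proof.
elim: d c => // d IH c hf; have lo j : (j < d)%N -> c j \in span P.
  move=> lt_jd; apply: (mulrn_pow2_inj lt_jd).
  apply: (IH (fun i => c i *+ 2 ^ i - c i *+ 2 ^ d)) lt_jd => k.
  have -> : \sum_(i < d) (c i *+ 2 ^ i - c i *+ 2 ^ d) *+ k ^ i =
      \sum_(i < d.+1) c i *+ (2 * k) ^ i -
      (\sum_(i < d.+1) c i *+ k ^ i) *+ 2 ^ d.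
    rewrite !big_ord_recr /= mulrnDl opprD addrACA -!mulrnA -expnMn.
    rewrite [(k * 2)%N]mulnC.
    rewrite subrr addr0 -sumrMnl -sumrB; apply: eq_bigr => i _.
    by rewrite mulrnBl -!mulrnA -expnMn [(2 ^ d * _)%N]mulnC.
  by apply: rpredB; rewrite ?rpredMn.
move=> j; rewrite ltnS leq_eqVlt => /orP[/eqP->|]; last exact: lo.
have := hf 1%N; rewrite big_ord_recr /= exp1n mulr1n rpredDl //.
by apply: rpred_sum => i _; rewrite rpredMn ?lo.
Qed.

End SpanDivision.

Section PrimitiveElements.
Variables (K : comAlgType rat) (U : algType K) (X : Type) (g : X -> U).
Hypothesis g0 : exists z, g z = 0.
Hypothesis g_linear : forall k x y, exists z, g z = k *: g x + g y.
Hypothesis g_bracket : forall x y, exists z, g z = g x * g y - g y * g x.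
Implicit Types (x y : X) (u w : U).

(** The spans [T N] form the standard filtration of the algebra generated by [g]. Writing them with
    [powers] is the surjectivity of symmetrization in the Poincaré-Birkhoff-Witt theorem. *)
Definition products N u :=
  exists2 s : seq X, (size s <= N)%N & u = \prod_(x <- s) g x.
Definition powers N u :=
  exists x k, (k <= N)%N /\ u = g x ^+ k.
Local Notation T N := (span (products N)).
Local Notation W N := (span (powers N)).

Lemma productsW M N u : (M <= N)%N -> u \in T M -> u \in T N.
Proof.
move=> le_MN; apply: span_subset => w [s le_s ->]; apply: span_gen.
by exists s => //; exact: leq_trans le_s le_MN.
Qed.

Lemma powersW M N u : (M <= N)%N -> u \in W M -> u \in W N.
Proof.
move=> le_MN; apply: span_subset => w [x [k [le_k ->]]]; apply: span_gen.
by exists x, k; split=> //; exact: leq_trans le_k le_MN.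
Qed.

Lemma productsM M N u w : u \in T M -> w \in T N -> u * w \in T (M + N).
Proof.
move=> /Defs.spanP + /Defs.spanP hw; elim=> [|k p {}u [s le_s ->] _ IH].
  by rewrite mul0r rpred0.
rewrite mulrDl -scalerAl; apply: rpredD => //; apply: rpredZ.
elim: hw {IH} => [|l q {}w [r le_r ->] _ IH]; first by rewrite mulr0 rpred0.
rewrite mulrDr -scalerAr; apply: rpredD => //; apply/rpredZ/span_gen.
by exists (s ++ r); rewrite ?big_cat // size_cat leq_add.
Qed.

Lemma products_gen x : g x \in T 1.
Proof. by apply: span_gen; exists [:: x]; rewrite ?big_seq1. Qed.

Lemma products_gen_pow x k : g x ^+ k \in T k.
Proof.
elim: k => [|k IH]; first by apply: span_gen; exists [::]; rewrite ?big_nil.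
by rewrite exprS -add1n; apply: productsM => //; exact: products_gen.
Qed.

(** Bracketing with [g y] is a derivation that replaces one factor by a single generator, so no
    product gets longer. *)
Lemma gen_pow_comm x y k : g y * g x ^+ k - g x ^+ k * g y \in T k.
Proof.
elim: k => [|k IH]; first by rewrite mulr1 mul1r subrr rpred0.
have [z ez] := g_bracket y x.
have -> : g y * g x ^+ k.+1 - g x ^+ k.+1 * g y =
    g z * g x ^+ k + g x * (g y * g x ^+ k - g x ^+ k * g y).
  by rewrite ez exprS mulrBl mulrBr !mulrA addrA subrK.
rewrite -add1n; apply: rpredD; apply: productsM => //; do ?exact: products_gen.
exact: products_gen_pow.
Qed.

(** The coefficient of ['X] in [P x y ^+ k.+1] is the sum of the [x^a y x^b] with [a + b = k], that
    is [(k+1) x^k y] modulo shorter products. *)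
Let P x y : {poly U} := (g x)%:P + (g y)%:P * 'X.

Let P_coef0 x y k : (P x y ^+ k)`_0 = g x ^+ k.
Proof.
elim: k => [|k IH]; first by rewrite coef1.
rewrite exprS coefM big_ord1 subnn IH /P coefD coefC coefMX eqxx addr0.
by rewrite exprS.
Qed.

Let P_coef1 x y k : (P x y ^+ k.+1)`_1 - (g x ^+ k * g y) *+ k.+1 \in T k.
Proof.
have P0 : (P x y)`_0 = g x by rewrite /P coefD coefC coefMX eqxx addr0.
have P1 : (P x y)`_1 = g y by rewrite /P coefD !coefC coefMX /= coefC add0r.
elim: k => [|k IH]; first by rewrite expr1 P1 mul1r subrr rpred0.
have -> : (P x y ^+ k.+2)`_1 - (g x ^+ k.+1 * g y) *+ k.+2 =
    g x * ((P x y ^+ k.+1)`_1 - (g x ^+ k * g y) *+ k.+1) +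
    (g y * g x ^+ k.+1 - g x ^+ k.+1 * g y).
  rewrite exprS coefM !big_ord_recl big_ord0 /= P0 P1 P_coef0 addr0.
  by rewrite [_ *+ k.+2]mulrSr opprD addrACA mulrBr mulrnAr mulrA -exprS.
rewrite -add1n; apply: rpredD; last exact: gen_pow_comm.
by apply: productsM => //; exact: products_gen.
Qed.

Let P_horner x y k i : exists z, (P x y ^+ k).[i%:R] = g z ^+ k.
Proof.
have [z ez] := g_linear i%:R y x; exists z.
(* The ring [U] need not be commutative; evaluation is multiplicative at natural numbers because
   they are central. *)
have c0 (p : {poly U}) : comm_poly p i%:R by exact/esym/commr_nat.
rewrite horner_exp_comm // /P hornerD hornerC hornerM_comm // hornerC hornerX.
by rewrite ez addrC scaler_nat mulr_natr.
Qed.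

(* Polarization: [x^k y] is, modulo shorter products, a linear combination of
   the powers of [x + i y], [i] a natural number. *)
Lemma products_powers N u : u \in T N -> u \in W N.
Proof.
elim: N u => [|N IH] u.
  have [z _] := g0.
  apply: span_subset => w [[|//] _ ->]; rewrite big_nil; apply: span_gen.
  by exists z, 0%N.
apply: span_subset => w [s]; case/lastP: s => [_ ->|s y].
  have [z _] := g0; rewrite big_nil; apply: span_gen.
  by exists z, 0%N.
rewrite size_rcons ltnS => le_s ->; rewrite -cats1 big_cat big_seq1 /=.
have : \prod_(x <- s) g x \in W N by apply/IH/span_gen; exists s.
move/Defs.spanP; elim=> [|c p {}w [x [k [le_kN ->]]] _ IHw].
  by rewrite mul0r rpred0.
rewrite mulrDl -scalerAl; apply: rpredD => //; apply: rpredZ.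
apply: (@span_mulrSn _ _ _ k); pose q := P x y ^+ k.+1.
have -> : g x ^+ k * g y *+ k.+1 = q`_1 - (q`_1 - (g x ^+ k * g y) *+ k.+1).
  by rewrite opprB addrC subrK.
apply: rpredB; last first.
  by apply/(powersW (leqnSn N))/IH/(productsW le_kN)/P_coef1.
case: (ltnP 1 (size q)) => [lt_1q|le_q1]; last by rewrite nth_default ?rpred0.
(* The values of [q] at natural numbers are powers, and [span_coef] recovers the coefficients of [q]
   from them. *)
apply: (span_coef _ lt_1q) => i; rewrite (_ : \sum_(j < size q) _ = q.[i%:R]).
  have [z ->] := P_horner x y k.+1 i; apply: span_gen.
  by exists z, k.+1.
by rewrite horner_coef; apply: eq_bigr => j _; rewrite -natrX mulr_natr.
Qed.

Variable hU : hopf_structure U.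
Hypothesis g_primitive : forall x, hopf_primitive hU (g x).

(** The convolution square of the identity, or second Adams operation. *)
Definition adams u : U := tlift (fun a b => a * b) (comul hU u).

Let mul_bilinear : bilinear2 (fun a b : U => a * b).
Proof. by apply: bilinear_mul. Qed.

Lemma adams_linear : linear adams.
Proof.
apply: (linear_comp (tlift_linear mul_bilinear)) => k u w; exact: linearP.
Qed.

Lemma adams_primitive u : comul hU u = tens 1 u + tens u 1 -> adams u = u *+ 2.
Proof.
have lin := tlift_linear mul_bilinear => e.
rewrite /adams e -[tens 1 u]scale1r lin scale1r !(tliftE mul_bilinear).
by rewrite mul1r mulr1.
Qed.

(** The coproduct of [x^k] stays in the span of the [x^i (x) x^j], where everything commutes; there,
    multiplying by [1 (x) x + x (x) 1] multiplies the image in [U] by [2 x]. *)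
Lemma adams_pow x k : adams (g x ^+ k) = g x ^+ k *+ 2 ^ k.
Proof.
pose mu := tlift (fun a b : U => a * b); pose d := tens 1 (g x) + tens (g x) 1.
pose Q (t : tensor U U) := exists i j, t = tens (g x ^+ i) (g x ^+ j).
have lmu : linear mu := tlift_linear mul_bilinear.
have muE a b : mu (tens a b) = a * b := tliftE mul_bilinear a b.
have dE i j : tmul d (tens (g x ^+ i) (g x ^+ j)) =
    tens (g x ^+ i) (g x ^+ j.+1) + tens (g x ^+ i.+1) (g x ^+ j).
  have := tmul_linearl (tens (g x ^+ i) (g x ^+ j)) 1 (tens 1 (g x))
    (tens (g x) 1).
  by rewrite /= !scale1r !tmulE !mul1r -!exprS.
have step t : t \in span Q ->
    tmul d t \in span Q /\ mu (tmul d t) = (g x * mu t) *+ 2.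
  move/Defs.spanP; elim=> [|c p t' [i [j ->]] _ [IH1 IH2]].
    rewrite (linear_fun0 (tmul_linearr d)) (linear_fun0 lmu) mulr0 mul0rn.
    by rewrite rpred0.
  have -> := tmul_linearr d c (tens (g x ^+ i) (g x ^+ j)) t'.
  rewrite dE; split.
    apply: rpredD => //; apply/rpredZ/rpredD; apply: span_gen.
      by exists i, j.+1.
    by exists i.+1, j.
  have muD :
      mu (tens (g x ^+ i) (g x ^+ j.+1) + tens (g x ^+ i.+1) (g x ^+ j)) =
      g x ^+ i * g x ^+ j.+1 + g x ^+ i.+1 * g x ^+ j.
    by rewrite -[tens _ _]scale1r lmu scale1r !muE.
  rewrite !lmu muD muE IH2.
  rewrite -!exprD addnS addSn mulrDr -scalerAr -exprS.
  by rewrite mulrnDl scalerMnr [_ ^+ _ *+ 2]mulr2n.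
have [_ cx] : comul hU (g x ^+ k) \in span Q /\
    mu (comul hU (g x ^+ k)) = g x ^+ k *+ 2 ^ k.
  elim: k => [|k [IH1 IH2]].
    rewrite comul1 muE mulr1; split=> //; apply: span_gen.
    by exists 0%N, 0%N.
  have [IH1' IH2'] := step _ IH1.
  rewrite exprS comulM (primitive_comul (g_primitive x)); split=> //.
  by rewrite IH2' IH2 mulrnAr -mulrnA expnSr -exprS.
exact: cx.
Qed.

Lemma powers_adams N u : u \in W N.+1 -> adams u - u *+ 2 ^ N.+1 \in W N.
Proof.
move/Defs.spanP; elim=> [|c p {}u [x [k [le_kN ->]]] _ IH].
  by rewrite (linear_fun0 adams_linear) mul0rn subr0 rpred0.
rewrite adams_linear adams_pow mulrnDl opprD addrACA; apply: rpredD => //.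
rewrite scalerMnr -scalerBr; apply: rpredZ; move: le_kN.
rewrite leq_eqVlt => /orP[/eqP ->|lt_kN]; first by rewrite subrr rpred0.
have xk : g x ^+ k \in W N by apply: span_gen; exists x, k.
by apply: rpredB; apply: rpredMn.
Qed.

(* On a combination of [N]-th powers the Adams operation [adams] is
   multiplication by [2^N], whereas it doubles a primitive element. *)
Lemma primitive_powers1 N u : comul hU u = tens 1 u + tens u 1 ->
  u \in W N -> u \in W 1.
Proof.
move=> /adams_primitive pu; elim: N => [|[|N] IH] hu //.
  exact: powersW hu.
apply: IH; apply: (@mulrn_pow2_inj _ _ _ 1 N.+2) => //.
by rewrite expn1 -pu; exact: powers_adams.
Qed.

Lemma powers1_split u : u \in W 1 -> exists c x, u = c *: 1 + g x.
Proof.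
move/Defs.spanP; elim=> [|c p {}u [x [k [le_k1 ->]]] _ [c' [x' ->]]].
  by have [z ez] := g0; exists 0, z; rewrite scale0r ez addr0.
case: k le_k1 => [|[|//]] _.
  by exists (c + c'), x'; rewrite expr0 scalerDl addrA.
by have [z ez] := g_linear c x x'; exists c', z; rewrite ez addrCA.
Qed.

Hypothesis g_generates : forall u, exists N, u \in T N.

Lemma primitive_gen u : hopf_primitive hU u -> exists x, u = g x.
Proof.
case=> cu _ eu; have [N hu] := g_generates u.
have [c [x e]] := powers1_split (primitive_powers1 cu (products_powers hu)).
(* The counit vanishes on [u] and on [g x], hence on the constant [c]. *)
exists x; have c0 : c = 0.
  move: eu; rewrite e linearP /= rmorph1 (primitive_counit (g_primitive x)).
  by rewrite addr0 => /eqP; rewrite -[_ *: _]/(c * 1) mulr1 => /eqP.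
by rewrite e c0 scale0r add0r.
Qed.

End PrimitiveElements.

(** * Generators and relations of the enveloping algebra *)

Lemma quota_piB (K : comNzRingType) (A : algType K) (Q : A -> Prop) (u w : A) :
  quota_pi Q (u - w) = quota_pi Q u - quota_pi Q w.
Proof. by rewrite -!scaleN1r quota_piD quota_piZ. Qed.

Lemma quota_pi_lin (K : comNzRingType) (A : algType K) (Q : A -> Prop) k
    (u w t : A) :
  quota_pi Q (t - (k *: u + w)) =
  quota_pi Q t - (k *: quota_pi Q u + quota_pi Q w).
Proof. by rewrite quota_piB quota_piD quota_piZ. Qed.

Lemma quota_pi_bracket (K : comNzRingType) (A : algType K) (Q : A -> Prop)
    (u w t : A) :
  quota_pi Q (t - (u * w - w * u)) =
  quota_pi Q t - (quota_mul (quota_pi Q u) (quota_pi Q w) -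
                  quota_mul (quota_pi Q w) (quota_pi Q u)).
Proof. by rewrite !quota_piB !quota_piM. Qed.

Section EnvelopingGenerators.
Variables (K : comAlgType rat) (E : algType K) (L : {pred E}).
Hypothesis L0 : 0 \in L.
Hypothesis L_linear : forall k x y, x \in L -> y \in L -> k *: x + y \in L.
Hypothesis L_bracket : forall x y, x \in L -> y \in L -> x * y - y * x \in L.
Local Notation U := (envalg L).
Local Notation g := (@env_gen K E L).
Implicit Types (x y : env_carrier L) (u w : U).

Lemma env_rel0 p : env_rel p -> quota_pi (@env_rel K E L) p = 0.
Proof.
move=> rp; rewrite -[RHS](@quotm_pi0 K _ (ideal_gen (@env_rel K E L))).
apply/quotm_eq; rewrite subr0; apply: span_gen.
by exists 1, p, 1; rewrite mul1r mulr1.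
Qed.

Lemma env_gen_linear k x y : exists z, g z = k *: g x + g y.
Proof.
pose z : env_carrier L :=
  Sub (k *: val x + val y) (L_linear k (valP x) (valP y)).
exists z; apply/eqP; rewrite -subr_eq0; apply/eqP.
have rz := env_rel0 (@env_rel_lin _ _ L k x y z erefl).
exact: etrans (esym (quota_pi_lin _ k _ _ _)) rz.
Qed.

Lemma env_gen_bracket x y : exists z, g z = g x * g y - g y * g x.
Proof.
pose z : env_carrier L :=
  Sub (val x * val y - val y * val x) (L_bracket (valP x) (valP y)).
exists z; apply/eqP; rewrite -subr_eq0; apply/eqP.
have rz := env_rel0 (@env_rel_bracket _ _ L x y z erefl).
exact: etrans (esym (quota_pi_bracket _ _ _ _)) rz.
Qed.

Lemma env_gen0 : exists z, g z = 0.
Proof.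
pose z : env_carrier L := Sub 0 L0.
have [z' ez'] := env_gen_linear (-1) z z.
by exists z'; rewrite ez' scaleN1r addNr.
Qed.

Lemma env_ind (Q : U -> Prop) :
    Q 1 -> (forall k u w, Q u -> Q w -> Q (k *: u + w)) ->
    (forall u w, Q u -> Q w -> Q (u * w)) -> (forall x, Q (g x)) ->
  forall u, Q u.
Proof.
move=> Q1 QD QM Qg u; rewrite -[u]quota_piK; move: (repr u).
apply: falg_ind => [|k a b Qa Qb|a b Qa Qb|x]; first exact: Q1.
- by rewrite quota_piD quota_piZ; exact: QD.
- by rewrite quota_piM; exact: QM.
- exact: Qg.
Qed.

Lemma env_gen_generates u : exists N, u \in Defs.span (products g N).
Proof.
move: u; apply: env_ind => [|k u w [N hu] [M hw]|u w [N hu] [M hw]|x].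
- by exists 0%N; apply: span_gen; exists [::]; rewrite ?big_nil.
- exists (maxn N M); apply: rpredD; first apply: rpredZ.
    exact: productsW (leq_maxl _ _) hu.
  exact: productsW (leq_maxr _ _) hw.
- by exists (N + M)%N; exact: productsM.
- by exists 1%N; exact: products_gen.
Qed.

Lemma env_primitive_gen (hU : hopf_structure U) u :
    (forall x, hopf_primitive hU (g x)) -> hopf_primitive hU u ->
  exists x, u = g x.
Proof.
move=> hg; apply: primitive_gen => //.
- exact: env_gen0.
- exact: env_gen_linear.
- exact: env_gen_bracket.
- exact: env_gen_generates.
Qed.

End EnvelopingGenerators.

(** * Hopf morphisms out of [NSym] through the [Psi_m] *)

Lemma tmap_primitive (K : comNzRingType) (A B : algType K)
    (f : {lrmorphism A -> B}) x :
  tmap f f (tens 1 x + tens x 1) = tens 1 (f x) + tens (f x) 1.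
Proof.
have lf : linear f by exact: linearP.
rewrite -[tens 1 x]scale1r (tmap_linear lf lf) scale1r !(tmapE _ _ lf lf).
by rewrite rmorph1.
Qed.

Lemma hopf_hom_primitive (K : comNzRingType) (A B : algType K)
    (hA : hopf_structure A) (hB : hopf_structure B) (f : {lrmorphism A -> B})
    x :
  is_hopf_hom hA hB f -> hopf_primitive hA x -> hopf_primitive hB (f x).
Proof.
move=> [fD fe fS] [xD xS xe]; split; last 2 first.
- by rewrite fS xS raddfN.
- by rewrite fe xe.
by rewrite fD xD tmap_primitive.
Qed.

Section PsiMorphism.
Variables (K : comAlgType rat) (Pi : tuple5 (NSym K)).
Hypothesis PiP : is_universal_tuple Pi.
Variables (hN : hopf_structure (NSym K)) (B : algType K).
Variables (hB : hopf_structure B) (f : {lrmorphism NSym K -> B}).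
Hypothesis hN_Psi : forall j, hopf_primitive hN (tup_h Pi j).
Hypothesis hB_Psi : forall j, hopf_primitive hB (f (tup_h Pi j)).

(** Compatibility with coproduct and counit holds on a subalgebra, so the [Psi_m] suffice; the
    antipode then follows. *)
Lemma hopf_hom_of_Psi : is_hopf_hom hN hB f.
Proof.
have lf : linear f by exact: linearP.
have lt := tmap_linear lf lf.
apply: hopf_hom_of_bialgebra_hom;
  apply: (NSym_Psi_ind PiP) => [|k x y hx hy|x y hx hy|j].
- by rewrite rmorph1 !comul1 (tmapE _ _ lf lf) rmorph1.
- by rewrite lf (linearP (comul hB)) hx hy (linearP (comul hN)) lt.
- by rewrite rmorphM comulM hx hy comulM tmap_tmul.
- rewrite (primitive_comul (hB_Psi j)) (primitive_comul (hN_Psi j)).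
  by rewrite tmap_primitive.
- by rewrite !rmorph1.
- rewrite lf; apply: etrans (_ : k *: counit hB (f x) + counit hB (f y) = _).
    exact: (linearP (counit hB)).
  by rewrite hx hy; apply/esym; exact: (linearP (counit hN)).
- rewrite rmorphM; apply: etrans (_ : counit hB (f x) * counit hB (f y) = _).
    exact: (rmorphM (counit hB)).
  by rewrite hx hy; apply/esym; exact: (rmorphM (counit hN)).
- by rewrite (primitive_counit (hB_Psi j)) (primitive_counit (hN_Psi j)).
Qed.

End PsiMorphism.

Lemma NSym_morphism_ext (K : comAlgType rat) (Pi : tuple5 (NSym K))
    (B : algType K) (f g : {lrmorphism NSym K -> B}) :
    is_universal_tuple Pi ->
  (forall j, f (tup_h Pi j) = g (tup_h Pi j)) -> f =1 g.
Proof.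
move=> PiP fg; apply: (NSym_Psi_ind PiP) => [|k x y ex ey|x y ex ey|//].
- by rewrite !rmorph1.
- apply: etrans (_ : k *: f x + f y = _); first exact: (linearP f).
  by rewrite ex ey; apply/esym; exact: (linearP g).
- by rewrite (rmorphM f) (rmorphM g) /= ex ey.
Qed.

Theorem theorem3p15 (K : comAlgType rat) (v : variables) (n : nat)
    (n_gt0 : (0 < n)%N) (alpha : nat) (alpha_gt0 : (0 < alpha)%N)
    (F : tautomorphism K v n alpha)
    (Omega : tuple5 (Dop K v n alpha)) (OmegaP : is_Omega F Omega)
    (Pi : tuple5 (NSym K)) (PiP : is_universal_tuple Pi)
    (hN : hopf_structure (NSym K))
    (hN_Psi : forall m, (0 < m)%N -> hopf_primitive hN (Psi_ Pi m))
    (hD : hopf_structure (UDop K v n alpha))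
    (hD_Der : forall delta : env_carrier (Der K v n alpha),
      hopf_primitive hD (env_gen delta)) :
  exists S : {lrmorphism NSym K -> UDop K v n alpha},
    [/\ is_hopf_hom hN hD S,
        tuple5_map (fun x => env_eval (S x)) Pi = Omega,
        forall m, (0 < m)%N ->
          [/\ env_eval (S (Lambda_ Pi m)) = Lambda_ Omega m,
              env_eval (S (S_ Pi m)) = S_ Omega m,
              env_eval (S (Psi_ Pi m)) = Psi_ Omega m,
              env_eval (S (Phi_ Pi m)) = Phi_ Omega m
            & env_eval (S (Xi_ Pi m)) = Xi_ Omega m]
      & forall S' : {lrmorphism NSym K -> UDop K v n alpha},
          is_hopf_hom hN hD S' ->
          tuple5_map (fun x => env_eval (S' x)) Pi = Omega -> S' =1 S].
Proof.
pose L := Der K v n alpha.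
(* The coefficient of [t^j] in [h(t)] is [psi_(j+1)], seen here as an element of the Lie algebra. *)
pose delta j : env_carrier L :=
  exist _ (dop_val (tup_h Omega j)) (Omega_h_Der alpha_gt0 OmegaP j).
have [S Sh] := NSym_lift PiP (fun j => env_gen (delta j)).
have Shj j : S (tup_h Pi j) = env_gen (delta j).
  by have := congr1 (fun u : nat -> UDop K v n alpha => u j) Sh.
have hPsi j : hopf_primitive hN (tup_h Pi j) by exact: (hN_Psi j.+1).
have [d0 expd] := Omega_texp alpha_gt0 OmegaP.
pose ev : {lrmorphism UDop K v n alpha -> Dop K v n alpha} := @env_eval _ _ L.
have mapS : tuple5_map (fun x => env_eval (S x)) Pi = Omega.
  apply: (universal_tuple_map PiP (phi := ev \o S)) => //.
  - exact: Omega_fg OmegaP.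
  - exact: Omega_gf OmegaP.
  - exact: Omega_g0 OmegaP.
  - exact: Omega_tderiv_h OmegaP.
  - exact: Omega_tderiv_m OmegaP.
  - apply/funext => j; rewrite /tcoef_map /= Shj env_evalE.
    exact: val_inj.
exists S; split=> //.
- by apply: (hopf_hom_of_Psi PiP) => // j; rewrite Shj.
- move=> m _; rewrite -mapS; split=> //.
  by rewrite /Phi_ !raddfMn.
(* Two morphisms need only be compared on the [Psi_m], and [S'] sends these to primitive
   elements. *)
move=> S' homS' mapS'; apply: (NSym_morphism_ext PiP) => j.
have := hopf_hom_primitive homS' (hPsi j).
move/(env_primitive_gen _ _ _ hD_Der) => [|||x S'x].
- exact: Der0.
- by move=> *; exact: Der_linear.
- by move=> *; exact: Der_bracket.
(* Both images are now generators; [env_eval] returns the underlying derivation of a generator, and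
   [mapS'] identifies it. *)
rewrite S'x Shj; congr env_gen; apply: val_inj.
have := congr1 (fun X => tup_h X j) mapS'.
by rewrite /= /tcoef_map S'x env_evalE => /(congr1 val).
Qed.
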